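(* Let $K \subset \mathbb R^3$ be a regular convex cone with everywhere positively curved boundary of class $C^k$, $k \geq 5$. Let $\gamma$ be the projective image of the boundary $\partial K$, a simple convex closed curve in the real projective plane $\mathbb{RP}^2$. Then there exists a $2\pi$-periodic parametrization of $\gamma$ of class $C^{k-1}$ by a real variable $t$ and a $2\pi$-periodic lift $y: \mathbb R \to \mathbb R^3$ of $\gamma$ of class $C^{k-2}$ such that $y(t)$ is a solution of the ordinary differential equation \[ y'''(t) + 2\alpha(t)y'(t) + \alpha'(t)y(t) + \beta(t)y(t) = 0 \] with $\alpha \equiv \mathrm{const}$ (and some $2\pi$-periodic function $\beta$). Here the value of the constant $\alpha$ is uniquely determined by the cone $K$.
   Context: A regular convex cone is a closed convex cone in $\mathbb R^3$ with non-empty interior and containing no lines. Because the boundary is positively curved, its projective image $\gamma$ is a closed convex curve of class $C^k$ without inflection points. Any regular parametrization of such a curve admits a lift $y(t)$ to $\mathbb R^3$, normalized so that $\det(y'',y',y) \equiv 1$, which solves the linear ODE $y''' + 2\alpha y' + \alpha' y + \beta y = 0$ for coefficient functions $\alpha,\beta$ (of class $C^{k-4}$, $C^{k-5}$ respectively); for a $2\pi$-periodic parametrization these coefficients are $2\pi$-periodic. The theorem asserts one can choose the periodic parametrization so that $\alpha$ is constant. *)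

(* Defs.v *)
From HB Require Import structures.
From mathcomp Require Import all_boot all_order all_algebra.
From mathcomp Require Import all_classical all_reals all_analysis.
Set Implicit Arguments. Unset Strict Implicit. Unset Printing Implicit Defensive.
Import Order.TTheory GRing.Theory Num.Theory.
Import numFieldNormedType.Exports.
Local Open Scope classical_set_scope.
Local Open Scope ring_scope.

Notation vec3 R := ('rV[R]_3).

Definition det3 {R : realType} (a b c : vec3 R) : R :=
  \det (\matrix_(i < 3, j < 3)
          (if i == 0 :> nat then a 0 j else if i == 1 :> nat then b 0 j else c 0 j)).

Definition Cn {R : realType} (V : normedModType R) (n : nat) (f : R -> V) : Prop :=
  (forall m, (m < n)%N -> forall t, derivable (derive1n m f) t 1) /\
  continuous (derive1n n f).

Definition periodic {R : realType} {V : Type} (T : R) (f : R -> V) : Prop :=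
  forall t, f (t + T) = f t.

Definition regular_convex_cone {R : realType} (K : set (vec3 R)) : Prop :=
  closed K /\
  (forall x y, K x -> K y -> forall l : R, 0 <= l <= 1 -> K (l *: x + (1 - l) *: y)) /\
  (forall x, K x -> forall l : R, 0 <= l -> K (l *: x)) /\
  K° !=set0 /\
  (forall x, K x -> K (- x) -> x = 0).

Definition bdry {R : realType} (K : set (vec3 R)) : set (vec3 R) := closure K `\` K°.

(* x : R -> R^3, T-periodic, traces every ray of the boundary of K (minus the
   origin) exactly once per period: it is a lift of a periodic parametrization
   of the projective curve gamma = P(bdry K \ {0}) *)
Definition lifts_boundary {R : realType} (K : set (vec3 R)) (T : R) (x : R -> vec3 R) : Prop :=
  periodic T x /\
  (forall p, (bdry K p /\ p <> 0) <-> exists l : R, exists s : R, 0 < l /\ p = l *: x s) /\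
  (forall s s' : R, 0 <= s < T -> 0 <= s' < T ->
     (exists l : R, 0 < l /\ x s' = l *: x s) -> s = s').

(* K has boundary (minus the origin) of class C^k which is everywhere positively
   curved: the boundary rays are traced by a C^k periodic lift x with
   det(x, x', x'') <> 0 (nonvanishing second fundamental form in the direction
   transverse to the rulings) *)
Definition Ck_pos_curved_boundary {R : realType} (K : set (vec3 R)) (k : nat) : Prop :=
  exists T : R, exists x : R -> vec3 R,
    0 < T /\ lifts_boundary K T x /\ Cn k x /\
    (forall s, det3 (x s) (derive1n 1 x s) (derive1n 2 x s) != 0).

(* the conclusion: a 2pi-periodic C^(k-1) parametrization of gamma (given through a
   C^(k-1) nonvanishing lift z of it), a 2pi-periodic C^(k-2) lift y of the same
   parametrization, normalized by det(y'',y',y) = 1, solving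
   y''' + 2 a y' + a' y + beta y = 0 with alpha = a constant (so a' = 0) and
   beta 2pi-periodic *)
Definition const_alpha_lift {R : realType} (K : set (vec3 R)) (k : nat)
    (y : R -> vec3 R) (a : R) (beta : R -> R) : Prop :=
  lifts_boundary K (2 * pi) y /\
  Cn (k - 2) y /\
  (exists z : R -> vec3 R, Cn (k - 1) z /\
     forall t, z t != 0 /\ exists mu : R, 0 < mu /\ y t = mu *: z t) /\
  (forall t, det3 (derive1n 2 y t) (derive1n 1 y t) (y t) = 1) /\
  periodic (2 * pi) beta /\
  (forall t, derive1n 3 y t + (2 * a) *: derive1n 1 y t + beta t *: y t = 0).

(* Main.v *)
(* The lift normalized by det (y'', y', y) = 1 satisfies y''' + 2 al y' + de y = 0, and a
   change of parameter with inverse derivative rho turns 2 al into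
   2 rho rho'' - rho'^2 + 2 al rho^2.  This is constant as soon as rho is a quadratic form
   in the solutions of Hill's equation v'' + (al / 2) v = 0, so that a constant al amounts
   to a positive quadratic form invariant under the monodromy of Hill's equation.

   Convexity enters through f(t) = det (y t, y' s, y s) and its dual
   h(t) = det (y s, y' t, y t), which are positive on ]s, s + T[.  They satisfy
   f'' h - f' h' + f (h'' + 2 al h) = 0, which makes
   v v' - (f' / f + h' / h) v^2 / 4 nondecreasing for every solution v.  Hence two zeros
   of v are at distance at least T, with equality only if de = al', in which case the
   monodromy is 1 or -1.

   Two solutions of the problem differ by a change of parameter whose inverse derivative mu
   is periodic with 2 mu mu'' - mu'^2 - 2 a1 + 2 a2 mu^2 = 0, while a1, a2 <= 1/2 by the
   bound on zeros.  If a2 < 1/2, the extrema of mu and the linear equation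
   satisfied by mu force a1 = a2, or mu constant and then equal to 1. *)
From Pilot Require Import Defs.
From HB Require Import structures.
From mathcomp Require Import all_boot all_order all_algebra.
From mathcomp Require Import all_classical all_reals all_analysis.
From mathcomp Require Import ring lra.
Set Implicit Arguments. Unset Strict Implicit. Unset Printing Implicit Defensive.
Import Order.TTheory GRing.Theory Num.Theory.
Import numFieldNormedType.Exports.
Import Pilot.Defs.
Local Open Scope classical_set_scope.
Local Open Scope ring_scope.

(** The weight 1/4 comes from the conic. If de = al' everywhere, then f and h are both half the
    square of the Hill solution u with u(s) = 0 and u'(s) = 1, so (f h)^(1/4) is |u| up to a factor,
    and the monotone quantity is v^2 (ln |v / u|)', with derivative the square (v' - u' v / u)^2.
    For a general curve the relation between f and h adds a second square, which measures f' / f -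
    h' / h: a deviation from the conic can only push zeros further apart.

    The quadratic form has to be positive only along the curve of solutions (v, w), not on the whole
    plane. Its discriminant, hence the constant alpha, can therefore have either sign.

    The bound 1/2 is the bound on zeros applied to sin (sqrt (a / 2) t). It is attained by the
    circular cone, where y''' + y' = 0. If both constants are 1/2, nothing is left to prove; if 0 <
    a2 < 1/2, then mu oscillates about a constant with frequency sqrt (2 a2) < 1, which the period 2
    pi does not allow.

    Two lifts are matched only ray by ray, so even the continuity of the change of parameter has to
    be extracted from the geometry. *)

Definition der {R : realType} {V : normedModType R} (f f' : R -> V) : Prop :=
  forall t : R, is_derive t (1 : R) f (f' t).

(** * Differentiation rules for functions, curves and determinants *)

Section derivatives.
Context {R : realType}.
Implicit Types (f g : R -> R) (t : R).

Lemma is_derive_ext {V : normedModType R} (f : R -> V) (t : R) (d e : V) :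
  is_derive t 1 f d -> d = e -> is_derive t 1 f e.
Proof. by move=> fd <-. Qed.

Lemma is_derive_uniq {V : normedModType R} (f : R -> V) (t : R) (d e : V) :
  is_derive t 1 f d -> is_derive t 1 f e -> d = e.
Proof. by move=> [_ <-] [_ <-]. Qed.

Lemma is_derive_continuous {V : normedModType R} (f : R -> V) t (d : V) :
  is_derive t 1 f d -> {for t, continuous f}.
Proof.
by move=> [fd _]; apply/differentiable_continuous; exact/derivable1_diffP.
Qed.

Lemma der_continuous {V : normedModType R} (f f' : R -> V) : der f f' -> continuous f.
Proof. by move=> ff' t; apply: is_derive_continuous (ff' t). Qed.

Lemma is_derive_const {V : normedModType R} (c : V) t : is_derive t 1 (fun _ => c) 0.
Proof. exact: is_derive_cst. Qed.

Lemma is_derive_var t : is_derive t 1 (fun s : R => s) 1.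
Proof. exact: is_derive_id. Qed.

Lemma is_derive_add {V : normedModType R} (f g : R -> V) t a b :
  is_derive t 1 f a -> is_derive t 1 g b ->
  is_derive t 1 (fun s => f s + g s) (a + b).
Proof. by move=> fa gb; apply: is_deriveD. Qed.

Lemma is_derive_opp {V : normedModType R} (f : R -> V) t a :
  is_derive t 1 f a -> is_derive t 1 (fun s => - f s) (- a).
Proof. by move=> fa; apply: is_deriveN. Qed.

Lemma is_derive_mul f g t a b :
  is_derive t 1 f a -> is_derive t 1 g b ->
  is_derive t 1 (fun s => f s * g s) (a * g t + f t * b).
Proof.
move=> fa gb; refine (is_derive_ext (@is_deriveM _ _ f g t 1 a b fa gb) _).
by rewrite /GRing.scale/=; ring.
Qed.

Lemma is_derive_inv f t a : f t != 0 ->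
  is_derive t 1 f a -> is_derive t 1 (fun s => (f s)^-1) (- a / f t ^+ 2).
Proof.
move=> ft0 fa; refine (is_derive_ext (@is_deriveV _ f t a 1 ft0 fa) _).
by rewrite /GRing.scale/=; ring.
Qed.

Lemma is_derive_pow f t a n : is_derive t 1 f a ->
  is_derive t 1 (fun s => f s ^+ n.+1) (n.+1%:R * f t ^+ n * a).
Proof.
move=> fa; elim: n => [|n ih].
  by refine (is_derive_ext fa _); rewrite expr0; ring.
under eq_fun do rewrite exprS.
refine (is_derive_ext (is_derive_mul fa ih) _).
by rewrite exprS -[n.+2%:R]natr1; ring.
Qed.

Lemma is_derive_comp f g t a b :
  is_derive (g t) 1 f a -> is_derive t 1 g b ->
  is_derive t 1 (fun s => f (g s)) (a * b).
Proof. exact: is_derive1_comp. Qed.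

Lemma is_derive_rowP {n} (y : R -> 'rV[R]_n) t d :
  is_derive t 1 y d <-> forall i, is_derive t 1 (fun s => y s 0 i) (d 0 i).
Proof.
split=> [[yd yE] i|H].
  have := (derivable_mxP _ _ _).1 yd ord0 i => yi.
  split => //; move: yE; rewrite derive_mx// => /matrixP /(_ 0 i).
  by rewrite mxE.
have yd : derivable y t 1.
  by apply/derivable_mxP => i j; rewrite (ord1 i); exact: ex_derive.
split => //; rewrite derive_mx//; apply/matrixP => i j; rewrite (ord1 i) mxE.
exact: derive_val.
Qed.

Lemma is_derive_scale {n} (f : R -> R) (y : R -> 'rV[R]_n) t a d :
  is_derive t 1 f a -> is_derive t 1 y d ->
  is_derive t 1 (fun s => f s *: y s) (a *: y t + f t *: d).
Proof.
move=> fa /is_derive_rowP yd; apply/is_derive_rowP => i.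
under eq_fun do rewrite mxE.
by refine (is_derive_ext (is_derive_mul fa (yd i)) _); rewrite !mxE.
Qed.

Lemma is_derive_row_comp {n} (y : R -> 'rV[R]_n) (g : R -> R) t d b :
  is_derive (g t) 1 y d -> is_derive t 1 g b ->
  is_derive t 1 (fun s => y (g s)) (b *: d).
Proof.
move=> /is_derive_rowP yd gb; apply/is_derive_rowP => i.
refine (is_derive_ext (is_derive_comp (yd i) gb) _).
by rewrite mxE mulrC.
Qed.

(** This expansion turns every determinant identity of the proof into a polynomial identity in
    coordinates, within reach of [ring]. *)
Lemma det3E (a b c : vec3 R) : det3 a b c =
  a 0 0 * (b 0 1 * c 0 2%:R - b 0 2%:R * c 0 1)
  - a 0 1 * (b 0 0 * c 0 2%:R - b 0 2%:R * c 0 0)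
  + a 0 2%:R * (b 0 0 * c 0 1 - b 0 1 * c 0 0).
Proof.
have rowE (v : vec3 R) (j : 'I_3) : v 0 j = [:: v 0 0; v 0 1; v 0 2%:R]`_j.
  by case: j => [[|[|[|//]]] j3] /=; congr (v 0 _); apply/val_inj.
pose w (v : vec3 R) (j : nat) := [:: v 0 0; v 0 1; v 0 2%:R]`_j.
pose r (i : nat) := if i == 0%N then a else if i == 1%N then b else c.
have -> : det3 a b c = \det (\matrix_(i < 3, j < 3) w (r i) j).
  congr (\det _); apply/matrixP => i j; rewrite !mxE /w -rowE /r.
  by case: ifP => // _; case: ifP.
rewrite (expand_det_row _ ord0) !big_ord_recl big_ord0 /cofactor.
rewrite !(expand_det_row _ ord0) !big_ord_recl !big_ord0 /cofactor !det_mx11 !mxE.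
rewrite /= /bump /= /r /w /=; ring.
Qed.

Lemma is_derive_det3 (a b c : R -> vec3 R) t a' b' c' :
  is_derive t 1 a a' -> is_derive t 1 b b' -> is_derive t 1 c c' ->
  is_derive t 1 (fun s => det3 (a s) (b s) (c s))
    (det3 a' (b t) (c t) + det3 (a t) b' (c t) + det3 (a t) (b t) c').
Proof.
move=> /is_derive_rowP aD /is_derive_rowP bD /is_derive_rowP cD.
under eq_fun do rewrite det3E.
rewrite !det3E; eapply is_derive_ext.
  repeat first [exact (aD _) | exact (bD _) | exact (cD _) |
    notypeclasses refine (is_derive_add _ _) | notypeclasses refine (is_derive_opp _) |
    notypeclasses refine (is_derive_mul _ _)].
cbv beta; ring.
Qed.

End derivatives.

(* [notypeclasses refine] keeps the library instances of the class [is_derive]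
   from being selected in place of the pointwise rules above. *)
Ltac derive_step := cbv beta; first [ match goal with
  | H : der ?f _ |- is_derive _ _ ?f _ => exact (H _)
  | H : is_derive ?t _ ?f _ |- is_derive ?t _ ?f _ => exact H
  end | lazymatch goal with
  | |- is_derive _ _ (fun _ => ?c) _ => notypeclasses refine (is_derive_const c _)
  | |- is_derive _ _ (fun s => s) _ => notypeclasses refine (is_derive_var _)
  | |- is_derive _ _ (fun s => @?f s + @?g s) _ =>
      notypeclasses refine (@is_derive_add _ _ f g _ _ _ _ _)
  | |- is_derive _ _ (fun s => - @?f s) _ =>
      notypeclasses refine (@is_derive_opp _ _ f _ _ _)
  | |- is_derive _ _ (fun s => @?f s * @?g s) _ =>
      notypeclasses refine (@is_derive_mul _ f g _ _ _ _ _)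
  | |- is_derive _ _ (fun s => @?f s ^+ _.+1) _ =>
      notypeclasses refine (@is_derive_pow _ f _ _ _ _)
  | |- is_derive _ _ (fun s => (@?f s)^-1) _ =>
      notypeclasses refine (@is_derive_inv _ f _ _ _ _)
  | |- is_derive _ _ (fun s => @?f s *: @?g s) _ =>
      notypeclasses refine (@is_derive_scale _ _ f g _ _ _ _ _)
  | |- is_derive _ _ (fun s => det3 (@?f s) (@?g s) (@?h s)) _ =>
      notypeclasses refine (@is_derive_det3 _ f g h _ _ _ _ _ _ _)
  | |- is_derive _ _ (fun s => ?f s) _ => match goal with
    | H : der f _ |- _ => exact (H _)
    | H : is_derive _ _ f _ |- _ => exact H
    end
  end ].

(** The goals left over are the nonvanishing of the denominators, then the equation between the
    computed and the announced derivative. *)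
Ltac derive_solve :=
  notypeclasses refine (is_derive_ext _ _); [repeat derive_step | cbv beta].

(** * Sign, monotonicity and extrema from derivatives *)

Section real_calculus.
Context {R : realType}.
Implicit Types (f g : R -> R) (t : R).

Lemma continuous_nearP f t : {for t, continuous f} <->
  forall e : R, 0 < e -> exists2 d : R, 0 < d & forall s, `|s - t| < d -> `|f s - f t| < e.
Proof.
split=> [/cvgrPdist_lt ft e e0|H].
  have /nbhs_ballP[d /= d0 fd] := ft _ e0.
  by exists d => // s sd; rewrite distrC; apply: fd; rewrite /ball/= distrC.
apply/cvgrPdist_lt => e e0; have [d d0 fd] := H _ e0.
apply/nbhs_ballP; exists d => //= s; rewrite /ball/= => sd.
by rewrite distrC; apply: fd; rewrite distrC.
Qed.

Lemma is_derive_bound f t d e : is_derive t 1 f d -> 0 < e ->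
  exists2 r : R, 0 < r & forall s, `|s - t| < r -> `|f s - f t - d * (s - t)| <= e * `|s - t|.
Proof.
move=> [fd fE] e0.
have : (h^-1 *: ((f \o shift t) (h *: 1) - f t) @[h --> 0^']) --> d by rewrite -fE.
move=> /cvgrPdist_lt /(_ _ e0) /nbhs_ballP[r /= r0 H].
exists r => // s sr.
have [->|st] := eqVneq s t; first by rewrite !subrr mulr0 subrr normr0 mulr0.
have st0 : s - t != 0 by rewrite subr_eq0.
have := H (s - t); rewrite /ball/= sub0r normrN => /(_ sr st0).
rewrite /GRing.scale/= mulr1 subrK => h.
have -> : f s - f t - d * (s - t) = - ((d - (s - t)^-1 * (f s - f t)) * (s - t)).
  by field.
by rewrite normrN normrM; apply: ler_wpM2r => //; exact: ltW.
Qed.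

Lemma is_derive_lipschitz f t d : is_derive t 1 f d ->
  exists2 r : R, 0 < r & forall s, `|s - t| < r -> `|f s - f t| <= (`|d| + 1) * `|s - t|.
Proof.
move=> /is_derive_bound /(_ ltr01)[r r0 H]; exists r => // s /H h.
have -> : f s - f t = d * (s - t) + (f s - f t - d * (s - t)) by ring.
rewrite mulrDl; apply: (le_trans (ler_normD _ _)).
by rewrite normrM; apply: lerD.
Qed.

Lemma is_derive_slope_gt f t d c : is_derive t 1 f d -> c < d ->
  exists2 r : R, 0 < r & forall s, `|s - t| < r ->
    c * (s - t) ^+ 2 <= (f s - f t) * (s - t).
Proof.
move=> fd cd; have [|r r0 H] := is_derive_bound fd (_ : 0 < d - c).
  by rewrite subr_gt0.
exists r => // s /H h.
have -> : (f s - f t) * (s - t) = d * (s - t) ^+ 2 + (f s - f t - d * (s - t)) * (s - t).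
  by ring.
have : `|(f s - f t - d * (s - t)) * (s - t)| <= (d - c) * (s - t) ^+ 2.
  rewrite normrM -[X in _ <= _ * X]real_normK ?num_real// expr2 mulrA.
  exact: ler_wpM2r.
rewrite ler_norml => /andP[h1 _]; lra.
Qed.

Lemma is_derive_gt0_near f t d : is_derive t 1 f d -> 0 < d -> f t = 0 ->
  exists2 r : R, 0 < r &
    (forall s, t < s < t + r -> 0 < f s) /\ (forall s, t - r < s < t -> f s < 0).
Proof.
move=> fd d0 ft; have d2 : d / 2 < d by lra.
have [r r0 H] := is_derive_slope_gt fd d2.
exists r => //; split => s sr.
  have := H s; rewrite ft subr0 => /(_ _) h.
  have : d / 2 * (s - t) ^+ 2 <= f s * (s - t) by apply: h; rewrite ger0_norm; lra.
  have st : 0 < s - t by lra.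
  rewrite expr2 mulrA ler_pM2r// => h2; apply: lt_le_trans h2.
  by rewrite mulr_gt0//; lra.
have := H s; rewrite ft subr0 => /(_ _) h.
have : d / 2 * (s - t) ^+ 2 <= f s * (s - t) by apply: h; rewrite ler0_norm; lra.
have st : s - t < 0 by lra.
rewrite expr2 mulrA ler_nM2r// => h2; apply: le_lt_trans h2 _.
by rewrite pmulr_rlt0//; lra.
Qed.

Lemma continuous_gt0_near f t : {for t, continuous f} -> 0 < f t ->
  exists2 r : R, 0 < r & forall s, `|s - t| < r -> 0 < f s.
Proof.
move=> /continuous_nearP ft ft0; have [r r0 H] := ft _ ft0.
by exists r => // s /H; rewrite ltr_norml => /andP[]; lra.
Qed.

Lemma within_continuous f a b : (forall t, a <= t <= b -> {for t, continuous f}) ->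
  {within `[a, b], continuous f}.
Proof.
move=> H; apply: continuous_in_subspaceT => t; rewrite inE/= in_itv/= => tab.
exact: H.
Qed.

Lemma mean_value f f' a b : a < b ->
  (forall t, a < t < b -> is_derive t 1 f (f' t)) ->
  (forall t, a <= t <= b -> {for t, continuous f}) ->
  exists2 c : R, a < c < b & f b - f a = f' c * (b - a).
Proof.
move=> ab fd fc.
have fd' t : t \in `]a, b[ -> is_derive t 1 f (f' t) by rewrite in_itv/=; exact: fd.
have [c] := MVT ab fd' (within_continuous fc).
by rewrite in_itv/= => cab ->; exists c.
Qed.

Lemma derive_ge0_le f f' a b : a <= b ->
  (forall t, a < t < b -> is_derive t 1 f (f' t)) ->
  (forall t, a <= t <= b -> {for t, continuous f}) ->
  (forall t, a < t < b -> 0 <= f' t) -> f a <= f b.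
Proof.
rewrite le_eqVlt => /predU1P[->//|ab] fd fc f'0.
have [c cab E] := mean_value ab fd fc.
by rewrite -subr_ge0 E mulr_ge0 ?f'0// subr_ge0 ltW.
Qed.

Lemma derive_gt0_lt f f' a b : a < b ->
  (forall t, a < t < b -> is_derive t 1 f (f' t)) ->
  (forall t, a <= t <= b -> {for t, continuous f}) ->
  (forall t, a < t < b -> 0 < f' t) -> f a < f b.
Proof.
move=> ab fd fc f'0; have [c cab E] := mean_value ab fd fc.
by rewrite -subr_gt0 E mulr_gt0 ?f'0// subr_gt0.
Qed.

Lemma derive_eq0_eq f f' a b : a <= b ->
  (forall t, a < t < b -> is_derive t 1 f (f' t)) ->
  (forall t, a <= t <= b -> {for t, continuous f}) ->
  (forall t, a < t < b -> f' t = 0) -> f a = f b.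
Proof.
rewrite le_eqVlt => /predU1P[->//|ab] fd fc f'0.
have [c cab] := mean_value ab fd fc.
by rewrite f'0// mul0r => /eqP; rewrite subr_eq0 => /eqP.
Qed.

Lemma der0_const f : der f (fun=> 0) -> forall s t, f s = f t.
Proof.
move=> f0 s t; wlog st : s t / s <= t.
  by move=> H; case: (leP s t) => [/H//|/ltW/H->].
apply: (derive_eq0_eq st (fun u _ => f0 u)) => // u _.
exact: der_continuous f0 u.
Qed.

Lemma derive_min0 f t d : is_derive t 1 f d -> (forall s, f t <= f s) -> d = 0.
Proof.
move=> fd fmin.
(* A positive derivative produces a smaller value to the left of [t]; a negative one reduces to this
   by reflection about [t]. *)
have key g e : is_derive t 1 g e -> 0 < e -> exists2 s : R, s < t & g s < g t.
  move=> ge e0.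
  have h : is_derive t 1 (fun s => g s - g t) e by derive_solve; ring.
  have [r r0 [_ H]] := is_derive_gt0_near h e0 (subrr _).
  exists (t - r / 2); first by lra.
  by have := H (t - r / 2); rewrite subr_lt0; apply; lra.
have [d0|d0|//] := ltgtP d 0.
  have h : is_derive t 1 (fun s => f (- (s - t) + t)) (- d).
    have h1 : is_derive t 1 (fun s : R => - (s - t) + t) (- 1).
      by derive_solve; ring.
    notypeclasses refine (is_derive_ext (is_derive_comp (f := f) (a := d) _ h1) _).
      by rewrite subrr oppr0 add0r.
    by ring.
  have [|s st] := key _ _ h; first by lra.
  by rewrite subrr oppr0 add0r ltNge fmin.
by have [s st] := key _ _ fd d0; rewrite ltNge fmin.
Qed.

Lemma derive_max0 f t d : is_derive t 1 f d -> (forall s, f s <= f t) -> d = 0.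
Proof.
move=> fd fmax; apply/eqP; rewrite -oppr_eq0; apply/eqP.
have h : is_derive t 1 (fun s => - f s) (- d) by derive_solve.
by apply: (derive_min0 h) => s; rewrite lerN2.
Qed.

Lemma derive2_min_ge0 f f' t d : der f f' -> is_derive t 1 f' d ->
  (forall s, f t <= f s) -> 0 <= d.
Proof.
move=> ff' f'd fmin; have f't := derive_min0 (ff' t) fmin.
rewrite leNgt; apply/negP => d0.
have h : is_derive t 1 (fun s => - f' s) (- d) by derive_solve.
have d0' : 0 < - d by lra.
have f't' : - f' t = 0 by rewrite f't oppr0.
have [r r0 [H _]] := is_derive_gt0_near h d0' f't'.
have fc := der_continuous ff'.
suff : - f t < - f (t + r / 2) by rewrite ltrN2 ltNge fmin.
apply: (@derive_gt0_lt (fun s => - f s) (fun s => - f' s)); first by lra.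
- by move=> s _; derive_solve.
- by move=> s _; apply: (@is_derive_continuous _ _ _ _ (- f' s)); derive_solve.
- by move=> s sr; apply: H; lra.
Qed.

Lemma derive2_max_le0 f f' t d : der f f' -> is_derive t 1 f' d ->
  (forall s, f s <= f t) -> d <= 0.
Proof.
move=> ff' f'd fmax; rewrite -oppr_ge0.
have h1 : der (fun s => - f s) (fun s => - f' s) by move=> s; derive_solve.
have h2 : is_derive t 1 (fun s => - f' s) (- d) by derive_solve.
by apply: (derive2_min_ge0 h1 h2) => s; rewrite lerN2.
Qed.

Lemma continuous_nonzero_gt0 f t0 : continuous f -> (forall t, f t != 0) ->
  0 < f t0 -> forall t, 0 < f t.
Proof.
move=> fc f0 ft0 t; rewrite lt_def f0/= leNgt; apply/negP => ft.
have [a [b [ab fab]]] : exists a b : R, a <= b /\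
    Num.min (f a) (f b) <= 0 <= Num.max (f a) (f b).
  have [tt|tt] := leP t t0; [exists t, t0|exists t0, t]; split; rewrite ?(ltW tt)//.
    by rewrite ge_min le_max !(ltW ft, ltW ft0) orbT.
  by rewrite ge_min le_max !(ltW ft, ltW ft0) orbT.
have [|c _ fc0] := IVT ab _ fab; last by move: (f0 c); rewrite fc0 eqxx.
by apply: within_continuous => s _; exact: fc.
Qed.

Lemma der_comp_affine f f' a b : der f f' ->
  der (fun t => f (a * t + b)) (fun t => a * f' (a * t + b)).
Proof.
move=> ff' t; have h : is_derive t 1 (fun s => a * s + b) a by derive_solve; ring.
exact: is_derive_ext (is_derive_comp (ff' _) h) (mulrC _ _).
Qed.

Lemma der_row_comp_affine n (y y' : R -> 'rV[R]_n) (a b : R) : der y y' ->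
  der (fun t => y (a * t + b)) (fun t => a *: y' (a * t + b)).
Proof.
move=> yy' t; have h : is_derive t 1 (fun s => a * s + b) a by derive_solve; ring.
exact: is_derive_row_comp (yy' _) h.
Qed.

Lemma der_periodic f f' T : der f f' -> periodic T f -> periodic T f'.
Proof.
move=> ff' fT t; have h := @der_comp_affine _ _ 1 T ff' t.
rewrite !mul1r in h; apply: is_derive_uniq h _.
by under eq_fun do rewrite mul1r fT.
Qed.

Lemma der_row_periodic n (y y' : R -> 'rV[R]_n) (T : R) :
  der y y' -> periodic T y -> periodic T y'.
Proof.
move=> yy' yT t; have h := @der_row_comp_affine _ _ _ 1 T yy' t.
rewrite scale1r mul1r in h; apply: is_derive_uniq h _.
by under eq_fun do rewrite mul1r yT.
Qed.

End real_calculus.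

(** * Closure properties of the class C^n *)

Section class_Cn.
Context {R : realType}.
Implicit Types (f g : R -> R).

Lemma der_derive1 {V : normedModType R} (f f' : R -> V) : der f f' -> f^`()%classic = f'.
Proof. by move=> ff'; apply/funext => t; rewrite derive1E; case: (ff' t). Qed.

Lemma CnS {V : normedModType R} n (f : R -> V) :
  Cn n.+1 f <-> exists2 f', der f f' & Cn n f'.
Proof.
split=> [[fd fc]|[f' ff' [f'd f'c]]].
  exists (f^`()%classic) => [t|].
    by have := fd 0%N (ltn0Sn _) t; rewrite derive1n0 derive1E => /derivableP.
  by split=> [m mn t|]; rewrite -derive1Sn; [exact: fd|].
split; last by rewrite derive1Sn (der_derive1 ff').
move=> [_ t|m mn t]; first by rewrite derive1n0; case: (ff' t).
by rewrite derive1Sn (der_derive1 ff'); exact: f'd.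
Qed.

Lemma Cn0 {V : normedModType R} (f : R -> V) : Cn 0 f <-> continuous f.
Proof. by split=> [[]|]. Qed.

Lemma Cn_der {V : normedModType R} n (f f' : R -> V) : der f f' -> Cn n f' -> Cn n.+1 f.
Proof. by move=> ff' Cf'; apply/CnS; exists f'. Qed.

Lemma Cn_derivative {V : normedModType R} n (f f' : R -> V) : der f f' -> Cn n.+1 f -> Cn n f'.
Proof.
by move=> ff' /CnS[g fg]; rewrite -(der_derive1 ff') -(der_derive1 fg).
Qed.

Lemma Cn_pred {V : normedModType R} n (f : R -> V) : Cn n.+1 f -> Cn n f.
Proof.
elim: n f => [|n ih] f /CnS[f' ff' Cf']; first by apply/Cn0; exact: der_continuous ff'.
by apply: Cn_der ff' (ih _ Cf').
Qed.

Lemma Cn_le {V : normedModType R} m n (f : R -> V) : (m <= n)%N -> Cn n f -> Cn m f.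
Proof.
move=> /subnK <-; elim: (n - m)%N => [//|k ih]; rewrite addSn => /Cn_pred; exact: ih.
Qed.

Lemma Cn_continuous {V : normedModType R} n (f : R -> V) : Cn n f -> continuous f.
Proof. by move=> /(Cn_le (leq0n n))/Cn0. Qed.

Lemma Cn_const n (c : R) : Cn n (fun _ : R => c).
Proof.
elim: n c => [|n ih] c; first by apply/Cn0; exact: cst_continuous.
by apply: (@Cn_der _ _ _ (fun=> 0)) (ih 0) => t; exact: is_derive_const.
Qed.

Lemma Cn_add n f g : Cn n f -> Cn n g -> Cn n (fun t => f t + g t).
Proof.
elim: n f g => [|n ih] f g.
  by move=> /Cn0 fc /Cn0 gc; apply/Cn0 => t; exact: cvgD (fc t) (gc t).
move=> /CnS[f' ff' Cf'] /CnS[g' gg' Cg']; apply: Cn_der (ih _ _ Cf' Cg') => t.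
by derive_solve.
Qed.

Lemma Cn_opp n f : Cn n f -> Cn n (fun t => - f t).
Proof.
elim: n f => [|n ih] f.
  by move=> /Cn0 fc; apply/Cn0 => t; exact: cvgN (fc t).
by move=> /CnS[f' ff' Cf']; apply: Cn_der (ih _ Cf') => t; derive_solve.
Qed.

Lemma Cn_mul n f g : Cn n f -> Cn n g -> Cn n (fun t => f t * g t).
Proof.
elim: n f g => [|n ih] f g.
  by move=> /Cn0 fc /Cn0 gc; apply/Cn0 => t; exact: cvgM (fc t) (gc t).
move=> Cf Cg; have [f' ff' Cf'] := (CnS _ _).1 Cf; have [g' gg' Cg'] := (CnS _ _).1 Cg.
apply: Cn_der (Cn_add (ih _ _ Cf' (Cn_pred Cg)) (ih _ _ (Cn_pred Cf) Cg')) => t.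
by derive_solve.
Qed.

Lemma Cn_inv n f : (forall t, f t != 0) -> Cn n f -> Cn n (fun t => (f t)^-1).
Proof.
move=> f0; elim: n => [|n ih].
  by move=> /Cn0 fc; apply/Cn0 => t; exact: cvgV (f0 t) (fc t).
move=> Cf; have [f' ff' Cf'] := (CnS _ _).1 Cf; have Ci := ih (Cn_pred Cf).
apply: Cn_der (Cn_mul (Cn_opp Cf') (Cn_mul Ci Ci)) => t.
by derive_solve; [exact: f0|rewrite expr2 invfM].
Qed.

Lemma Cn_comp n f g : Cn n f -> Cn n g -> Cn n (fun t => f (g t)).
Proof.
elim: n f g => [|n ih] f g.
  move=> /Cn0 fc /Cn0 gc; apply/Cn0 => t.
  exact: (@continuous_comp _ _ _ g f t (gc t) (fc (g t))).
move=> Cf Cg; have [f' ff' Cf'] := (CnS _ _).1 Cf; have [g' gg' Cg'] := (CnS _ _).1 Cg.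
apply: Cn_der (Cn_mul (ih _ _ Cf' (Cn_pred Cg)) Cg') => t.
exact: is_derive_comp (ff' _) (gg' _).
Qed.

Lemma Cn_expR n f : Cn n f -> Cn n (fun t => expR (f t)).
Proof.
suff Ce m : Cn m (@expR R) by exact: Cn_comp.
elim: m => [|m ih]; first by apply/Cn0; exact: continuous_expR.
by apply: Cn_der ih => t; exact: is_derive_expR.
Qed.

Lemma is_derive_ln_comp f t d : 0 < f t -> is_derive t 1 f d ->
  is_derive t 1 (fun s => ln (f s)) (d / f t).
Proof.
move=> ft fd; exact: is_derive_ext (is_derive_comp (is_derive1_ln ft) fd) (mulrC _ _).
Qed.

Lemma Cn_ln n f : (forall t, 0 < f t) -> Cn n f -> Cn n (fun t => ln (f t)).
Proof.
move=> f0; case: n => [|n] Cf.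
  apply/Cn0 => t; have fc := Cn_continuous Cf.
  exact: (@continuous_comp _ _ _ f (@ln R) t (fc t) (continuous_ln (f0 t))).
have [f' ff' Cf'] := (CnS _ _).1 Cf.
have Ci : Cn n (fun t => (f t)^-1) by apply: Cn_inv (Cn_pred Cf) => t; rewrite gt_eqF.
by apply: Cn_der (Cn_mul Cf' Ci) => t; exact: is_derive_ln_comp.
Qed.

Lemma continuous_rowP {n} (y : R -> 'rV[R]_n) :
  continuous y <-> forall i, continuous (fun t => y t 0 i).
Proof.
split=> [yc i t|yc t].
  apply: (@continuous_comp _ _ _ y (fun M : 'rV[R]_n => M 0 i)); first exact: yc.
  exact: coord_continuous.
apply/cvgrPdist_lt => e e0.
have H i : \forall s \near t, `|y t 0 i - y s 0 i| < e.
  by have /cvgrPdist_lt := yc i t; exact.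
have : \forall s \near t, forall i, `|y t 0 i - y s 0 i| < e.
  exact: (@filter_forall _ _ (fun i s => `|y t 0 i - y s 0 i| < e) _ _ H).
apply: filterS => s hs; rewrite [ltLHS]/Num.Def.normr/= mx_normrE.
apply/bigmax_ltP; split => // -[i j] _; rewrite (ord1 i) !mxE; exact: hs.
Qed.

Lemma Cn_rowP {m} n (y : R -> 'rV[R]_m) : Cn n y <-> forall i, Cn n (fun t => y t 0 i).
Proof.
elim: n y => [|n ih] y.
  rewrite Cn0 continuous_rowP; split=> H i; first by apply/Cn0; exact: H.
  by apply/Cn0; exact: H.
split=> [/CnS[y' yy' /ih Cy'] i|H].
  by apply: Cn_der (Cy' i) => t; have /is_derive_rowP := yy' t; apply.
have /choice[d dP] : forall i, exists d, der (fun t => y t 0 i) d /\ Cn n d.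
  by move=> i; have /CnS[d d1 d2] := H i; exists d.
apply: (@Cn_der _ _ _ (fun t => \row_i d i t)) => [t|].
  by apply/is_derive_rowP => i; rewrite mxE; have [+ _] := dP i; exact.
apply/ih => i; under eq_fun do rewrite mxE.
by have [] := dP i.
Qed.

Lemma Cn_scale {m} n f (y : R -> 'rV[R]_m) : Cn n f -> Cn n y -> Cn n (fun t => f t *: y t).
Proof.
move=> Cf /Cn_rowP Cy; apply/Cn_rowP => i; under eq_fun do rewrite mxE.
exact: Cn_mul.
Qed.

Lemma Cn_row_comp {m} n (y : R -> 'rV[R]_m) g :
  Cn n y -> Cn n g -> Cn n (fun t => y (g t)).
Proof.
by move=> /Cn_rowP Cy Cg; apply/Cn_rowP => i; exact: (Cn_comp (Cy i) Cg).
Qed.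

End class_Cn.

Ltac Cn_step := cbv beta; first [ match goal with
  | H : Cn ?n ?f |- Cn ?n ?f => exact H
  end | lazymatch goal with
  | |- Cn _ (fun _ => ?c) => exact (Cn_const _ c)
  | |- Cn _ (fun s => @?f s + @?g s) => refine (@Cn_add _ _ f g _ _)
  | |- Cn _ (fun s => - @?f s) => refine (@Cn_opp _ _ f _)
  | |- Cn _ (fun s => @?f s * @?g s) => refine (@Cn_mul _ _ f g _ _)
  | |- Cn _ (fun s => @?f s *: @?g s) => refine (@Cn_scale _ _ _ f g _ _)
  | |- Cn ?n (fun s => ?f s) => match goal with H : Cn n f |- _ => exact H end
  end ].

Section class_Cn_det.
Context {R : realType}.

Lemma Cn_det3 n (a b c : R -> vec3 R) : Cn n a -> Cn n b -> Cn n c ->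
  Cn n (fun t => det3 (a t) (b t) (c t)).
Proof.
move=> /Cn_rowP Ca /Cn_rowP Cb /Cn_rowP Cc; under eq_fun do rewrite det3E.
repeat Cn_step; lazymatch goal with
  | |- Cn _ (fun s => fun_of_matrix (a s) _ ?i) => exact (Ca i)
  | |- Cn _ (fun s => fun_of_matrix (b s) _ ?i) => exact (Cb i)
  | |- Cn _ (fun s => fun_of_matrix (c s) _ ?i) => exact (Cc i)
  end.
Qed.

Lemma Cn_opp_arg {m} n (y : R -> 'rV[R]_m) : Cn n y -> Cn n (fun t => y (- t)).
Proof.
move=> Cy; apply: (Cn_row_comp Cy); apply: Cn_opp.
case: n {Cy} => [|n]; first by apply/Cn0 => t; exact: cvg_id.
by apply: Cn_der (Cn_const _ 1) => t; exact: is_derive_var.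
Qed.

End class_Cn_det.

(** * Primitives, uniform limits and the solution of Hill's equation *)

Section linear_ode.
Context {R : realType}.
Implicit Types (f g q : R -> R) (t : R).

Lemma primitive_half_line f a : continuous f ->
  exists F : R -> R, forall t, a < t -> is_derive t 1 F (f t).
Proof.
move=> fc; exists (fun x => \int[lebesgue_measure]_(t in `[a, x]) f t)%R => t at_.
have fi : lebesgue_measure.-integrable `[a, t + 1] (EFin \o f).
  apply: continuous_compact_integrable; first exact: segment_compact.
  by apply: continuous_subspaceT => s; exact: fc.
have [|Fd FE] := @continuous_FTC1_closed R f a t (t + 1) _ fi at_ (fc t); first lra.
by split; [exact: Fd|rewrite -derive1E; exact: FE].
Qed.

(** Integrals from two base points differ by a constant to the right of both. The base point [A t]
    lies to the left of 0 and of [t], so the difference of values at [t] and 0 does not depend on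
    it, and near a given [t] one base point serves for all arguments. *)
Lemma primitive_exists f : continuous f -> exists2 F : R -> R, der F f & F 0 = 0.
Proof.
move=> fc.
have /choice[G GP] : forall a, exists F : R -> R, forall t, a < t -> is_derive t 1 F (f t).
  by move=> a; exact: primitive_half_line.
have GE a b s t : a < s -> b < s -> s <= t -> G a t - G a s = G b t - G b s.
  move=> as_ bs st.
  have d u : s <= u -> is_derive u 1 (fun x => G a x - G b x) 0.
    move=> su; have h1 := GP a u (lt_le_trans as_ su); have h2 := GP b u (lt_le_trans bs su).
    by derive_solve; ring.
  have E : G a s - G b s = G a t - G b t.
    apply: (@derive_eq0_eq _ (fun x => G a x - G b x) (fun=> 0)) => // u.
      by move=> /andP[/ltW/d].
    by move=> /andP[su _]; exact: is_derive_continuous (d u su).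
  lra.
have GE' a b s t : a < s -> b < s -> a < t -> b < t -> G a t - G a s = G b t - G b s.
  move=> as_ bs at_ bt; have [st|ts] := leP s t; first exact: GE.
  by have := GE a b t s at_ bt (ltW ts); lra.
pose A t : R := - (`|t| + 1).
have A0 t : A t < 0 by rewrite /A oppr_lt0 ltr_wpDl.
have At t : A t < t.
  by rewrite /A; have := ler_norm (- t); rewrite normrN; lra.
exists (fun t => G (A t) t - G (A t) 0); last by rewrite subrr.
move=> t; pose b := A t - 1.
have h : is_derive t 1 (fun s => G b s - G b 0) (f t).
  have h1 := GP b t; have bt : b < t by rewrite /b; have := At t; lra.
  by have h2 := h1 bt; derive_solve; ring.
apply: near_eq_is_derive h; apply/nbhs_ballP; exists 1 => //= s.
rewrite /ball/= ltr_norml => /andP[h1 h2]; apply: GE'.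
- by rewrite /b; have := A0 t; lra.
- exact: A0.
- rewrite /b /A; have := ler_norm (- t); rewrite normrN; lra.
- exact: At.
Qed.

(** Each integration gains a factor |t| / (n + 1); this is the source of the factorials in the
    Picard bounds. *)
Lemma prim_pow_bound F f (N c : R) n : der F f -> F 0 = 0 ->
  (forall t, `|t| <= N -> `|f t| <= c * `|t| ^+ n) ->
  forall t, `|t| <= N -> `|F t| <= c * `|t| ^+ n.+1 / n.+1%:R.
Proof.
have pos F' f' : der F' f' -> F' 0 = 0 ->
    (forall t, `|t| <= N -> `|f' t| <= c * `|t| ^+ n) ->
    forall t, 0 <= t -> t <= N -> `|F' t| <= c * t ^+ n.+1 / n.+1%:R.
  move=> Ff F0 fb t t0 tN.
  have n0 : n.+1%:R != 0 :> R by rewrite pnatr_eq0.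
  have main G g : der G g -> G 0 = 0 -> (forall s, 0 <= s <= t -> g s <= c * s ^+ n) ->
      G t <= c * t ^+ n.+1 / n.+1%:R.
    move=> Gg G0 gb; rewrite -subr_ge0.
    have d : der (fun s => c * s ^+ n.+1 / n.+1%:R - G s) (fun s => c * s ^+ n - g s).
      by move=> s; derive_solve; field.
    have -> : 0 = c * 0 ^+ n.+1 / n.+1%:R - G 0 by rewrite G0 expr0n/=; ring.
    apply: (derive_ge0_le t0 (fun s _ => d s)) => s.
      by move=> _; exact: der_continuous d s.
    by move=> /andP[s0 st]; rewrite subr_ge0; apply: gb; rewrite !ltW.
  rewrite ler_norml; apply/andP; split; last first.
    apply: (main _ _ Ff F0) => s /andP[s0 st]; have := fb s.
    rewrite (ger0_norm s0) => h; apply: le_trans (ler_norm _) (h _); exact: le_trans tN.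
  rewrite lerNl; have d : der (fun s => - F' s) (fun s => - f' s) by move=> s; derive_solve.
  apply: (main _ _ d); first by rewrite F0 oppr0.
  move=> s /andP[s0 st]; have := fb s.
  rewrite (ger0_norm s0) => h; apply: le_trans (ler_norm _) _.
  by rewrite normrN; apply: h; exact: le_trans tN.
move=> Ff F0 fb t tN; have [t0|t0] := leP 0 t.
  by rewrite (ger0_norm t0); apply: (pos _ _ Ff F0 fb) => //; move: tN; rewrite ger0_norm.
have d : der (fun s => - F (- s)) (fun s => f (- s)).
  move=> s; have h : is_derive s 1 (fun u : R => - u) (- 1) by derive_solve.
  have h2 := is_derive_comp (Ff (- s)) h.
  by derive_solve; ring.
rewrite (ltr0_norm t0); have -> : `|F t| = `|- F (- - t)| by rewrite normrN opprK.
apply: (pos _ _ d); first by rewrite oppr0 F0 oppr0.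
- by move=> s; have := fb (- s); rewrite normrN.
- by rewrite oppr_ge0 ltW.
- by move: tN; rewrite ltr0_norm.
Qed.

Lemma series_tail (u M : nat -> R) : (forall n, `|u n| <= M n) -> cvgn (series M) ->
  forall n, `|(limn (series u) : R) - (series u n : R)| <= (limn (series M) : R) - series M n.
Proof.
move=> uM cM n.
have M0 k : 0 <= M k by apply: le_trans (uM k).
have cu : cvgn (series u).
  by apply: normed_cvg; apply: series_le_cvg cM => // k; exact: normr_ge0.
have h m : (n <= m)%N -> `|series u m - series u n| <= limn (series M) - series M n.
  move=> nm; rewrite sub_series_geq//.
  apply: (@le_trans _ _ (series M m - series M n)).
    rewrite sub_series_geq//; apply: (le_trans (ler_norm_sum _ _ _)).
    exact: ler_sum.
  rewrite lerD2r; apply: (nondecreasing_cvgn_le _ cM).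
  by apply: nondecreasing_series => k _ _; exact: M0.
rewrite ler_norml lerBrDr lerBlDr; apply/andP; split.
  apply: limr_ge => //; exists n => //= m /h.
  by rewrite ler_norml => /andP[+ _]; lra.
apply: limr_le => //; exists n => //= m /h.
by rewrite ler_norml => /andP[_ +]; lra.
Qed.

Lemma uniform_limit_continuous_at (S : R -> R) (Sn : nat -> R -> R) t r : 0 < r ->
  (forall n, continuous (Sn n)) ->
  (forall e : R, 0 < e -> exists n, forall s, `|s - t| < r -> `|S s - Sn n s| <= e) ->
  {for t, continuous S}.
Proof.
move=> r0 Sc H; apply/continuous_nearP => e e0.
have [|n nP] := H (e / 4); first lra.
have /continuous_nearP/(_ (e / 4))[|d d0 dP] := Sc n t; first lra.
exists (Num.min d r); first by rewrite lt_min d0.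
move=> s; rewrite lt_min => /andP[sd sr].
have h1 := nP s sr; have h2 := dP s sd.
have h3 : `|S t - Sn n t| <= e / 4 by apply: nP; rewrite subrr normr0.
have -> : S s - S t = (S s - Sn n s) + (Sn n s - Sn n t) - (S t - Sn n t) by ring.
by apply: (le_lt_trans (ler_normB _ _)); have := ler_normD (S s - Sn n s) (Sn n s - Sn n t); lra.
Qed.

Lemma uniform_limit_derive (S D : R -> R) (Sn Dn : nat -> R -> R) t r : 0 < r ->
  (forall n, der (Sn n) (Dn n)) ->
  (forall e : R, 0 < e -> exists n, forall s, `|s - t| < r ->
     `|S s - Sn n s| <= e /\ `|D s - Dn n s| <= e) ->
  {for t, continuous D} ->
  is_derive t 1 S (D t).
Proof.
move=> r0 Sd H /continuous_nearP Dc.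
have key e : 0 < e -> exists2 d : R, 0 < d & forall s, `|s - t| < d ->
    `|S s - S t - D t * (s - t)| <= e * `|s - t|.
  move=> e0; have [|d d0 dP] := Dc (e / 2); first lra.
  exists (Num.min d r); first by rewrite lt_min d0.
  move=> s; rewrite lt_min => /andP[sd sr].
  have [->|st] := eqVneq s t; first by rewrite !subrr mulr0 subrr normr0 mulr0.
  have st0 : 0 < `|s - t| by rewrite normr_gt0 subr_eq0.
  (* The radius [d] is fixed before the index [n]. The approximation error is not proportional to |s
     - t|, so it is charged to an arbitrary [eps], on which only [n] depends. *)
  apply/ler_addgt0Pr => eps eps0.
  pose m := Num.min (e / 2) (eps / 2).
  have m0 : 0 < m by rewrite lt_min; lra.
  have [n nP] := H m m0.
  have [c cst cE] : exists2 c, `|c - t| <= `|s - t| &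
      Sn n s - Sn n t = Dn n c * (s - t).
    have Snc := der_continuous (Sd n).
    have [lt_st|lt_ts|E] := ltgtP s t; last by rewrite E eqxx in st.
      have [c /andP[c1 c2] cE] := mean_value lt_st (fun u _ => Sd n u) (fun u _ => Snc u).
      exists c; last by lra.
      by rewrite !ltr0_norm; lra.
    have [c /andP[c1 c2] cE] := mean_value lt_ts (fun u _ => Sd n u) (fun u _ => Snc u).
    exists c; last by lra.
    by rewrite !gtr0_norm; lra.
  have tr : `|t - t| < r by rewrite subrr normr0.
  have cr : `|c - t| < r by apply: le_lt_trans sr.
  have cd : `|c - t| < d by apply: le_lt_trans sd.
  have [h1 _] := nP s sr; have [h2 _] := nP t tr; have [_ h3] := nP c cr.
  have h4 := dP c cd.
  have -> : S s - S t - D t * (s - t) =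
      (S s - Sn n s) - (S t - Sn n t) + ((D c - D t) - (D c - Dn n c)) * (s - t).
    by have -> : S s - S t = (S s - Sn n s) - (S t - Sn n t) + Dn n c * (s - t);
      [rewrite -cE|]; ring.
  apply: (le_trans (ler_normD _ _)); rewrite [e * _ + _]addrC; apply: lerD.
    apply: (le_trans (ler_normB _ _)).
    have : m <= eps / 2 by rewrite ge_min lexx orbT.
    by lra.
  rewrite normrM ler_pM2r//; apply: (le_trans (ler_normB _ _)).
  have : m <= e / 2 by rewrite ge_min lexx.
  by lra.
have cv : (h^-1 *: ((S \o shift t) (h *: 1) - S t) @[h --> 0^']) --> D t.
  apply/cvgrPdist_le => e e0; have [d d0 dP] := key _ e0.
  apply/nbhs_ballP; exists d => //= h; rewrite /ball/= sub0r normrN => hd h0.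
  have := dP (h + t); rewrite addrK => /(_ hd).
  rewrite /GRing.scale/= mulr1.
  have -> : S (h + t) - S t - D t * h = - ((D t - h^-1 * (S (h + t) - S t)) * h) by field.
  by rewrite normrN normrM ler_pM2r// normr_gt0.
by split; [apply/cvg_ex; exists (D t)|exact: cvg_lim cv].
Qed.

Lemma continuous_bounded f (N : R) : continuous f -> 0 <= N ->
  exists2 B : R, 1 <= B & forall t, `|t| <= N -> `|f t| <= B.
Proof.
move=> fc N0.
have nc : {within `[- N, N], continuous (fun t => `|f t|)}.
  apply: within_continuous => t _.
  exact: (@continuous_comp _ _ _ f Num.norm t (fc t) (@norm_continuous _ _ _)).
have [|c _ cP] := EVT_max _ nc; first lra.
exists (1 + `|f c|); first by rewrite lerDl.
move=> t; rewrite ler_norml => tN; apply: (le_trans (cP t _)).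
  by rewrite in_itv/=.
by rewrite lerDr.
Qed.

(** Picard iteration for the system v' = w, w' = - q v. The increments of the iteration are summed
    as a series dominated by an exponential series on each bounded interval. *)
Theorem hill_exists q (a b : R) : continuous q ->
  exists v v' : R -> R, [/\ der v v', der v' (fun t => - q t * v t), v 0 = a & v' 0 = b].
Proof.
move=> qc.
(* A total primitive operator is needed for the recursion; off the continuous functions its value is
   arbitrary. *)
have /choice[P PP] : forall f, exists F : R -> R, continuous f -> der F f /\ F 0 = 0.
  move=> f; case: (pselect (continuous f)) => [/primitive_exists[F Ff F0]|nf].
    by exists F.
  by exists f.
pose U : nat -> (R -> R) * (R -> R) :=
  fix U n := if n is n'.+1 then (P (U n').2, P (fun t => - q t * (U n').1 t))
             else (fun=> a, fun=> b).
have Uc n : continuous (U n).1 /\ continuous (U n).2.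
  elim: n => [|n [ih1 ih2]]; first by split; exact: cst_continuous.
  have [h1 _] := PP _ ih2.
  have c2 : continuous (fun t => - q t * (U n).1 t).
    by move=> t; apply: cvgM (ih1 t); exact: cvgN (qc t).
  have [h2 _] := PP _ c2.
  by split; [exact: der_continuous h1|exact: der_continuous h2].
have qUc n : continuous (fun t => - q t * (U n).1 t).
  by move=> t; apply: cvgM ((Uc n).1 t); exact: cvgN (qc t).
have U1 n : der (U n.+1).1 (U n).2 /\ (U n.+1).1 0 = 0 by apply: PP; have [] := Uc n.
have U2 n : der (U n.+1).2 (fun t => - q t * (U n).1 t) /\ (U n.+1).2 0 = 0.
  by apply: PP.
pose C := `|a| + `|b|.
(* Only the second component picks up a factor q at each step; [1 <= B] allows the same bound for
   both. *)
have bound (N B : R) : 1 <= B -> (forall t, `|t| <= N -> `|q t| <= B) ->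
    forall n t, `|t| <= N -> `|(U n).1 t| <= C * B ^+ n / n`!%:R * `|t| ^+ n /\
                `|(U n).2 t| <= C * B ^+ n / n`!%:R * `|t| ^+ n.
  move=> B1 qB; elim=> [|n ih].
    by move=> t _; rewrite !expr0 fact0 !mulr1 invr1 mulr1 /= /C lerDl lerDr.
  have c0 : 0 <= C * B ^+ n / n`!%:R.
    by rewrite !mulr_ge0// ?addr_ge0// exprn_ge0//; lra.
  have E t : C * B ^+ n.+1 / n.+1`!%:R * `|t| ^+ n.+1 =
      C * B ^+ n / n`!%:R * B * `|t| ^+ n.+1 / n.+1%:R.
    rewrite factS natrM exprS; field.
    by rewrite !pnatr_eq0 -lt0n fact_gt0 nat1r pnatr_eq0.
  move=> t tN; rewrite E; split.
    have [d d0] := U1 n; apply: (prim_pow_bound d d0 _ tN) => s sN.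
    apply: (le_trans (ih s sN).2); apply: ler_wpM2r; first exact: exprn_ge0.
    by rewrite ler_peMr.
  have [d d0] := U2 n; apply: (prim_pow_bound d d0 _ tN) => s sN.
  rewrite normrM normrN mulrAC; apply: le_trans (ler_pM _ _ (qB s sN) (ih s sN).1) _ => //.
  by rewrite mulrC.
pose M N B : nat -> R := fun n => C * exp_coeff (B * N) n.
have cM N B : cvgn (series (M N B)).
  have -> : M N B = (C : R^o) *: (exp_coeff (B * N) : nat -> R^o) by [].
  exact: is_cvg_seriesZ (is_cvg_series_exp_coeff (B * N)).
have boundM N B : 1 <= B -> (forall t, `|t| <= N -> `|q t| <= B) ->
    forall t, `|t| <= N -> forall n, `|(U n).1 t| <= M N B n /\ `|(U n).2 t| <= M N B n.
  move=> B1 qB t tN n; have [h1 h2] := bound N B B1 qB n t tN.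
  suff h : C * B ^+ n / n`!%:R * `|t| ^+ n <= M N B n.
    by split; [exact: le_trans h1 h|exact: le_trans h2 h].
  rewrite /M /exp_coeff /= exprMn.
  have -> : C * (B ^+ n * N ^+ n / n`!%:R) = C * B ^+ n / n`!%:R * N ^+ n by ring.
  apply: ler_wpM2l; last by apply: lerXn2r; rewrite ?nnegrE//; exact: le_trans tN.
  by rewrite !mulr_ge0// ?addr_ge0// exprn_ge0//; lra.
pose S1 n t := series (fun k => (U k).1 t) n.
pose S2 n t := series (fun k => (U k).2 t) n.
pose v t := limn (series (fun k => (U k).1 t)).
pose w t := limn (series (fun k => (U k).2 t)).
have unif (N : R) : 0 <= N -> forall e, 0 < e -> exists n0, forall n, (n0 <= n)%N ->
    forall t, `|t| <= N -> `|v t - S1 n t| <= e /\ `|w t - S2 n t| <= e.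
  move=> N0 e e0; have [B B1 qB] := continuous_bounded qc N0.
  have /cvgrPdist_le/(_ _ e0)[n0 _ n0P] := cM N B.
  exists n0 => n nn t tN; have hM := boundM N B B1 qB t tN.
  have := n0P n nn => /= h.
  split; apply: le_trans (series_tail _ (cM N B) n) (le_trans (ler_norm _) h) => k.
    by have [] := hM k.
  by have [] := hM k.
have S10 : S1 0%N = (fun=> 0) by apply/funext => t; rewrite /S1 /series/= big_geq.
have S1S n : S1 n.+1 = (fun t => S1 n t + (U n).1 t).
  by apply/funext => t; rewrite /S1 /series/= big_nat_recr.
have S1c n : continuous (S1 n).
  elim: n => [|n ih]; first by rewrite S10; exact: cst_continuous.
  by rewrite S1S => t; exact: cvgD (ih t) ((Uc n).1 t).
have S20 : S2 0%N = (fun=> 0) by apply/funext => t; rewrite /S2 /series/= big_geq.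
have S2S n : S2 n.+1 = (fun t => S2 n t + (U n).2 t).
  by apply/funext => t; rewrite /S2 /series/= big_nat_recr.
have S2c n : continuous (S2 n).
  elim: n => [|n ih]; first by rewrite S20; exact: cst_continuous.
  by rewrite S2S => t; exact: cvgD (ih t) ((Uc n).2 t).
have tN t s : `|s - t| < 1 -> `|s| <= `|t| + 1.
  move=> st; have -> : s = t + (s - t) by ring.
  by apply: (le_trans (ler_normD _ _)); rewrite lerD2l ltW.
have N0 t : 0 <= `|t| + 1 by rewrite addr_ge0.
have vc : continuous v.
  move=> t; apply: (uniform_limit_continuous_at ltr01 S1c) => e e0.
  have [n0 n0P] := unif _ (N0 t) e e0; exists n0 => s /tN sN.
  by have [] := n0P n0 (leqnn _) s sN.
have wc : continuous w.
  move=> t; apply: (uniform_limit_continuous_at ltr01 S2c) => e e0.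
  have [n0 n0P] := unif _ (N0 t) e e0; exists n0 => s /tN sN.
  by have [] := n0P n0 (leqnn _) s sN.
have S1d n : der (S1 n.+1) (S2 n).
  elim: n => [|n ih] t.
    by rewrite S1S S10 S20 /=; derive_solve; ring.
  have [h _] := U1 n; rewrite S1S S2S.
  by derive_solve.
have S2d n : der (S2 n.+1) (fun t => - q t * S1 n t).
  elim: n => [|n ih] t.
    by rewrite S2S S20 S10 /=; derive_solve; ring.
  have [h _] := U2 n; rewrite S2S S1S.
  by derive_solve; rewrite mulrDr.
have at0 (f : nat -> R) c : f 0%N = c -> (forall n, f n.+1 = 0) -> limn (series f) = c.
  move=> f0 fS; apply: cvg_lim => //; apply: (@cvg_near_cst _ _ _ _ _ _).
  exists 1%N => //= -[//|n] _; rewrite /series/= big_nat_recl//= f0 big1 ?addr0// => i _.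
exists v, w; split.
- move=> t; apply: (@uniform_limit_derive v w (fun n => S1 n.+1) S2 t 1 ltr01 S1d); last exact: wc.
  move=> e e0; have [n0 n0P] := unif _ (N0 t) e e0; exists n0 => s /tN sN.
  by split; [have [] := n0P n0.+1 (leqnSn _) s sN|have [] := n0P n0 (leqnn _) s sN].
- move=> t; apply: (@uniform_limit_derive w (fun t => - q t * v t) (fun n => S2 n.+1)
    (fun n t => - q t * S1 n t) t 1 ltr01 S2d); last first.
    by apply: cvgM (vc t); exact: cvgN (qc t).
  move=> e e0; have [B B1 qB] := continuous_bounded qc (N0 t).
  have [|n0 n0P] := unif _ (N0 t) (e / B); first by rewrite divr_gt0//; lra.
  have eB : e / B <= e by rewrite ler_pdivrMr ?ler_peMr//; lra.
  exists n0 => s /tN sN; have [_ h2] := n0P n0.+1 (leqnSn _) s sN.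
  have [h1 _] := n0P n0 (leqnn _) s sN.
  split; first exact: le_trans eB.
  rewrite -mulrBr normrM normrN; apply: le_trans (ler_pM _ _ (qB s sN) h1) _ => //.
  by rewrite mulrC divfK// gt_eqF//; lra.
- by apply: at0 => // n; exact: (U1 n).2.
- by apply: at0 => // n; exact: (U2 n).2.
Qed.

End linear_ode.

Record normalized_lift {R : realType} (K : set (vec3 R)) (T : R)
    (y y1 y2 y3 : R -> vec3 R) : Prop := NormalizedLift {
  lift_cone : regular_convex_cone K;
  lift_period : 0 < T;
  lift_bdry : lifts_boundary K T y;
  lift_der1 : der y y1;
  lift_der2 : der y1 y2;
  lift_der3 : der y2 y3;
  lift_det : forall t, det3 (y2 t) (y1 t) (y t) = 1 }.

(** * Interior points of the cone and rays of its boundary *)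

Section convexity.
Context {R : realType}.
Implicit Types (K : set (vec3 R)) (a b c p w : vec3 R).

Lemma row3P (v w : vec3 R) :
  v 0 0 = w 0 0 -> v 0 1 = w 0 1 -> v 0 2%:R = w 0 2%:R -> v = w.
Proof.
move=> e0 e1 e2; apply/rowP => -[[|[|[|//]]] i3].
- by rewrite (_ : Ordinal i3 = 0)//; apply/val_inj.
- by rewrite (_ : Ordinal i3 = 1)//; apply/val_inj.
- by rewrite (_ : Ordinal i3 = 2%:R)//; apply/val_inj.
Qed.

Lemma det3_cramer a b c w : det3 a b c *: w =
  det3 w b c *: a + det3 a w c *: b + det3 a b w *: c.
Proof. by apply: row3P; rewrite !mxE !det3E; ring. Qed.

Lemma det3_basis a b c w : det3 a b c = 1 ->
  w = det3 w b c *: a + det3 a w c *: b + det3 a b w *: c.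
Proof. by move=> d1; rewrite -det3_cramer d1 scale1r. Qed.

Lemma continuous_det3 (A B C : vec3 R -> vec3 R) : continuous A -> continuous B ->
  continuous C -> continuous (fun w => det3 (A w) (B w) (C w)).
Proof.
move=> Ac Bc Cc w.
have cc (V : vec3 R -> vec3 R) i : continuous V -> V w0 0 i @[w0 --> w] --> V w 0 i.
  move=> Vc; apply: (@continuous_comp _ _ _ V (fun M : vec3 R => M 0 i)); first exact: Vc.
  exact: coord_continuous.
have a i := cc A i Ac; have b i := cc B i Bc; have c i := cc C i Cc.
rewrite /continuous_at det3E; under eq_fun do rewrite det3E.
exact: (cvgD (cvgB (cvgM (a 0) (cvgB (cvgM (b 1) (c 2%:R)) (cvgM (b 2%:R) (c 1))))
                   (cvgM (a 1) (cvgB (cvgM (b 0) (c 2%:R)) (cvgM (b 2%:R) (c 0)))))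
             (cvgM (a 2%:R) (cvgB (cvgM (b 0) (c 1)) (cvgM (b 1) (c 0))))).
Qed.

Lemma cone_add K : regular_convex_cone K -> forall a b, K a -> K b -> K (a + b).
Proof.
move=> [_ [Kc [Kz _]]] a b Ka Kb.
have -> : a + b = 2 *: (2^-1 *: a + (1 - 2^-1) *: b).
  by apply/rowP => i; rewrite !mxE; field.
by apply: Kz => //; apply: Kc => //; lra.
Qed.

(** The three products are the coordinates of [p] in the basis a, b, c up to a common positive
    factor, and they stay positive near [p] by continuity. Multiplying by [det3 a b c] makes the
    criterion independent of the orientation of the basis. *)
Lemma simplicial_cone_interior K a b c p : regular_convex_cone K -> K a -> K b -> K c ->
  0 < det3 p b c * det3 a b c -> 0 < det3 a p c * det3 a b c ->
  0 < det3 a b p * det3 a b c -> K° p.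
Proof.
move=> HK Ka Kb Kc h1 h2 h3; have [_ [_ [Kz _]]] := HK.
have near_pos (f : vec3 R -> R) : continuous f -> 0 < f p * det3 a b c ->
    \forall w \near p, 0 < f w * det3 a b c.
  move=> fc fp; have : f w * det3 a b c @[w --> p] --> f p * det3 a b c.
    exact: (cvgM (fc p) (cvg_cst _)).
  by move=> /cvgr_gt; apply.
have cst (v : vec3 R) : continuous (fun _ : vec3 R => v).
  by move=> w; exact: (@cst_continuous _ _ v).
have id_c : continuous (fun w : vec3 R => w) by move=> w; exact: cvg_id.
have n1 := near_pos _ (continuous_det3 id_c (cst b) (cst c)) h1.
have n2 := near_pos _ (continuous_det3 (cst a) id_c (cst c)) h2.
have n3 := near_pos _ (continuous_det3 (cst a) (cst b) id_c) h3.
rewrite /interior /=; move: n1 n2 n3; apply: filterS3 => w w1 w2 w3.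
have D0 : det3 a b c != 0 by apply/eqP => D0; rewrite D0 mulr0 ltxx in w1.
have E : w = (det3 a b c ^+ 2)^-1 *: ((det3 w b c * det3 a b c) *: a +
   (det3 a w c * det3 a b c) *: b + (det3 a b w * det3 a b c) *: c).
  have -> : (det3 w b c * det3 a b c) *: a + (det3 a w c * det3 a b c) *: b +
      (det3 a b w * det3 a b c) *: c = det3 a b c *: (det3 a b c *: w).
    by rewrite (det3_cramer a b c w) !scalerDr !scalerA !(mulrC (det3 a b c)).
  by rewrite !scalerA expr2 mulVf ?scale1r// mulf_neq0.
rewrite E; apply: (Kz); last by rewrite invr_ge0 sqr_ge0.
by apply: cone_add => //; [apply: cone_add => //|]; apply: (Kz) => //; exact: ltW.
Qed.

(** Iterated, this reads the sign of a function just after a zero from its first nonvanishing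
    derivative there. *)
Lemma der_pos_right (g g' : R -> R) : der g g' -> g 0 = 0 ->
  (exists2 r : R, 0 < r & forall e, 0 < e < r -> 0 < g' e) ->
  exists2 r : R, 0 < r & forall e, 0 < e < r -> 0 < g e.
Proof.
move=> gg' g0 [r r0 H]; exists r => // e /andP[e0 er]; rewrite -g0.
apply: (derive_gt0_lt e0 (fun s _ => gg' s)) => s; first by move=> _; exact: der_continuous gg' s.
by move=> /andP[s0 se]; apply: H; rewrite s0/=; exact: lt_trans er.
Qed.

Lemma is_derive_pos_right (g : R -> R) (d : R) : is_derive (0 : R) 1 g d -> 0 < d -> g 0 = 0 ->
  exists2 r : R, 0 < r & forall e, 0 < e < r -> 0 < g e.
Proof.
move=> gd d0 g0; have [r r0 [H _]] := is_derive_gt0_near gd d0 g0.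
by exists r => // e; have := H e; rewrite add0r.
Qed.

Lemma continuous_pos_right (g : R -> R) : {for (0 : R), continuous g} -> 0 < g 0 ->
  exists2 r : R, 0 < r & forall e, 0 < e < r -> 0 < g e.
Proof.
move=> gc g0; have [r r0 H] := continuous_gt0_near gc g0.
by exists r => // e /andP[e0 er]; apply: H; rewrite subr0 gtr0_norm.
Qed.

Lemma common_pos_right (P1 P2 P3 : R -> Prop) :
  (exists2 r : R, 0 < r & forall e, 0 < e < r -> P1 e) ->
  (exists2 r : R, 0 < r & forall e, 0 < e < r -> P2 e) ->
  (exists2 r : R, 0 < r & forall e, 0 < e < r -> P3 e) ->
  exists e, [/\ P1 e, P2 e & P3 e].
Proof.
move=> [r1 r10 H1] [r2 r20 H2] [r3 r30 H3].
pose e := Num.min r1 (Num.min r2 r3) / 2.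
have m0 : 0 < Num.min r1 (Num.min r2 r3) by rewrite !lt_min r10 r20.
have e0 : 0 < e by rewrite /e; lra.
have em : e < Num.min r1 (Num.min r2 r3) by rewrite /e; lra.
by move: (em); rewrite !lt_min => /andP[e1 /andP[e2 e3]];
  exists e; split; [apply: H1|apply: H2|apply: H3]; rewrite e0.
Qed.

Lemma periodic_nat {V : Type} (T : R) (x : R -> V) n t :
  periodic T x -> x (t + n%:R * T) = x t.
Proof.
move=> xT; elim: n => [|n ih]; first by rewrite mul0r addr0.
by rewrite -[n.+1%:R]natr1 mulrDl mul1r addrA xT.
Qed.

Lemma periodic_int {V : Type} (T : R) (x : R -> V) (n : int) t :
  periodic T x -> x (t + n%:~R * T) = x t.
Proof.
move=> xT; case: n => n; first exact: periodic_nat.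
rewrite NegzE mulrNz mulNr; have := @periodic_nat _ _ _ n.+1 (t - n.+1%:~R * T) xT.
by rewrite subrK.
Qed.

Lemma period_reduce (T : R) t : 0 < T -> exists n : int, 0 <= t + n%:~R * T < T.
Proof.
move=> T0; exists (- Num.floor (t / T)).
have /andP[h1 h2] := floor_itv (t / T).
rewrite mulrNz mulNr subr_ge0 -ler_pdivlMr// h1/= ltrBlDr.
by move: h2; rewrite ltr_pdivrMr// intrD mulrDl mul1r addrC.
Qed.

(** Injectivity is given on [0, T[ only. Reducing both parameters to that window shows that equal
    rays have parameters differing by an integer multiple of [T], and no such multiple lies strictly
    between 0 and [T]. *)
Lemma lifts_boundary_inj K (T : R) (x : R -> vec3 R) : 0 < T -> lifts_boundary K T x ->
  forall s s' l, 0 < s' - s < T -> 0 < l -> x s' <> l *: x s.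
Proof.
move=> T0 [xT [_ inj]] s s' l ss' l0 E; have [n nP] := period_reduce s T0.
have [m mP] := period_reduce s' T0.
have : s + n%:~R * T = s' + m%:~R * T.
  by apply: inj => //; exists l; rewrite !periodic_int.
move=> e; have {e} : s' - s = (n - m)%:~R * T by rewrite intrB mulrBl; lra.
move=> e; move: ss'; rewrite e pmulr_lgt0// ltr0z => /andP[k0].
rewrite -[X in _ < X]mul1r ltr_pM2r// ltrz1.
by move: (n - m) k0 => k; rewrite gtz0_ge1 leNgt => /negbTE ->.
Qed.

Lemma lift_in K T y y1 y2 y3 : normalized_lift K T y y1 y2 y3 -> forall t, K (y t).
Proof.
move=> [[Kc _] _ [_ [bd _]] _ _ _ _] t.
have [_ /(_ _)[|[+ _] _]] := bd (y t); first by exists 1, t; rewrite scale1r.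
by rewrite -(closure_id _).1.
Qed.

Lemma lift_not_interior K T y y1 y2 y3 : normalized_lift K T y y1 y2 y3 ->
  forall t, ~ K° (y t).
Proof.
move=> [_ _ [_ [bd _]] _ _ _ _] t.
by have [_ /(_ _)[|[_ +] _]] := bd (y t); first by exists 1, t; rewrite scale1r.
Qed.

End convexity.

(** * The cone lies strictly on one side of its tangent planes *)

Section tangent_planes.
Context {R : realType} {K : set (vec3 R)} {T : R} {y y1 y2 y3 : R -> vec3 R}.

(* The linear form whose kernel is the tangent plane of the cone along the ray of [y s]. *)
Definition tangent_form (y y1 : R -> vec3 R) (s t : R) : R := det3 (y t) (y1 s) (y s).

Hypothesis lift : normalized_lift K T y y1 y2 y3.

Let yK : forall t, K (y t) := lift_in lift.
Let ybd : forall t, ~ K° (y t) := lift_not_interior lift.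
Let d1 : der y y1 := lift_der1 lift.
Let d2 : der y1 y2 := lift_der2 lift.
Let d3 : der y2 y3 := lift_der3 lift.
Let dt1 : forall t, det3 (y2 t) (y1 t) (y t) = 1 := lift_det lift.

Lemma det3_0r (a b : vec3 R) : det3 a b 0 = 0.
Proof. by rewrite det3E !mxE; ring. Qed.

Lemma tangent_form_der s : der (tangent_form y y1 s) (fun t => det3 (y1 t) (y1 s) (y s)).
Proof.
move=> t; rewrite /tangent_form; derive_solve; rewrite !det3E !mxE; ring.
Qed.

Lemma tangent_form_der2 s :
  der (fun t => det3 (y1 t) (y1 s) (y s)) (fun t => det3 (y2 t) (y1 s) (y s)).
Proof. move=> t; derive_solve; rewrite !det3E !mxE; ring. Qed.

Lemma tangent_form_self s : tangent_form y y1 s s = 0.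
Proof. by rewrite /tangent_form det3E; ring. Qed.

(** If [y t] were on the wrong side of the tangent plane at [s], then [y s] would be interior to the
    simplicial cone on y (s + e), y (s - e) and [y t] for small e > 0, although it is a boundary
    point. *)
Lemma tangent_form_ge0 s t : 0 <= tangent_form y y1 s t.
Proof.
rewrite leNgt; apply/negP => Fneg; set p := y s; set c := y t in Fneg.
pose a0 e := y (1 * e + s); pose a1 e := y1 (1 * e + s); pose a2 e := y2 (1 * e + s).
pose b0 e := y (-1 * e + s); pose b1 e := y1 (-1 * e + s); pose b2 e := y2 (-1 * e + s).
pose a3 e := y3 (1 * e + s); pose b3 e := y3 (-1 * e + s).
have da0 : der a0 (fun e => 1 *: a1 e) by exact: der_row_comp_affine.
have da1 : der a1 (fun e => 1 *: a2 e) by exact: der_row_comp_affine.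
have da2 : der a2 (fun e => 1 *: a3 e) by exact: der_row_comp_affine.
have db0 : der b0 (fun e => -1 *: b1 e) by exact: der_row_comp_affine.
have db1 : der b1 (fun e => -1 *: b2 e) by exact: der_row_comp_affine.
have db2 : der b2 (fun e => -1 *: b3 e) by exact: der_row_comp_affine.
have at0 : [/\ a0 0 = p, b0 0 = p, a1 0 = y1 s, b1 0 = y1 s &
               a2 0 = y2 s /\ b2 0 = y2 s].
  by rewrite /a0 /a1 /a2 /b0 /b1 /b2 !mulr0 !add0r.
have [ea0 eb0 ea1 eb1 [ea2 eb2]] := at0.
have Fn : det3 c (y1 s) p < 0 by [].
have G1 : exists2 r : R, 0 < r & forall e, 0 < e < r -> 0 < - det3 (a0 e) (b0 e) c.
  have h : is_derive (0 : R) 1 (fun e => - det3 (a0 e) (b0 e) c) (- (2 * det3 c (y1 s) p)).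
    by derive_solve; rewrite ea0 eb0 ea1 eb1 !det3E !mxE; ring.
  by apply: is_derive_pos_right h _ _; [lra|rewrite ea0 eb0 det3E; ring].
have G23 : exists2 r : R, 0 < r & forall e, 0 < e < r ->
    0 < - det3 p (b0 e) c /\ 0 < - det3 (a0 e) p c.
  have h2 : is_derive (0 : R) 1 (fun e => - det3 p (b0 e) c) (- det3 c (y1 s) p).
    by derive_solve; rewrite ?ea0 eb0 ?ea1 ?eb1 !det3E !mxE; ring.
  have h3 : is_derive (0 : R) 1 (fun e => - det3 (a0 e) p c) (- det3 c (y1 s) p).
    by derive_solve; rewrite ?ea0 ?eb0 ?ea1 ?eb1 !det3E !mxE; ring.
  have [||r2 r20 H2] := is_derive_pos_right h2; [lra|rewrite eb0 det3E; ring|].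
  have [||r3 r30 H3] := is_derive_pos_right h3; [lra|rewrite ea0 det3E; ring|].
  exists (Num.min r2 r3); first by rewrite lt_min r20.
  move=> e; rewrite lt_min => /andP[e0 /andP[e2 e3]].
  by split; [apply: H2|apply: H3]; rewrite e0.
(* By the normalization this determinant is - e^3 to leading order, hence the third derivative 6 and
   the two intermediate derivatives. *)
have G4 : exists2 r : R, 0 < r & forall e, 0 < e < r -> 0 < - det3 (a0 e) (b0 e) p.
  pose g1 e := det3 (a0 e) (b1 e) p - det3 (a1 e) (b0 e) p.
  pose g2 e := 2 * det3 (a1 e) (b1 e) p - det3 (a2 e) (b0 e) p - det3 (a0 e) (b2 e) p.
  have h1 : der (fun e => - det3 (a0 e) (b0 e) p) g1.
    by move=> e; rewrite /g1; derive_solve; rewrite !det3E !mxE; ring.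
  have h2 : der g1 g2.
    by move=> e; rewrite /g1 /g2; derive_solve; rewrite !det3E !mxE; ring.
  have h3 : is_derive (0 : R) 1 g2 6.
    rewrite /g2; derive_solve.
    have := dt1 s; rewrite -/p => dd.
    have -> : 6 = 6 * det3 (y2 s) (y1 s) p by rewrite dd mulr1.
    by rewrite ea0 eb0 ea1 eb1 ea2 eb2 !det3E !mxE; ring.
  apply: der_pos_right h1 _ _; first by rewrite ea0 eb0 det3E; ring.
  apply: der_pos_right h2 _ _; first by rewrite /g1 ea0 eb0 ea1 eb1 !det3E; ring.
  apply: is_derive_pos_right h3 _ _; first by [].
  by rewrite /g2 ea0 eb0 ea1 eb1 ea2 eb2 !det3E; ring.
have [e [p1 [p2 p3] p4]] := common_pos_right G1 G23 G4.
apply: (@ybd s); apply: (simplicial_cone_interior (lift_cone lift) (yK (1 * e + s))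
  (yK (-1 * e + s)) (yK t)); rewrite -/(a0 e) -/(b0 e) -/c -/p; nra.
Qed.

Lemma tangent_form_pos_near s b : b != 0 ->
  exists2 r : R, 0 < r & forall e, 0 < e < r -> 0 < tangent_form y y1 s (b * e + s).
Proof.
move=> b0.
have h1 := der_comp_affine b s (tangent_form_der s).
have h2 : der (fun e => b * det3 (y1 (b * e + s)) (y1 s) (y s))
    (fun e => b * (b * det3 (y2 (b * e + s)) (y1 s) (y s))).
  have h := der_comp_affine b s (tangent_form_der2 s).
  by move=> e; derive_solve; ring.
apply: der_pos_right h1 _ _; first by rewrite mulr0 add0r tangent_form_self.
have h3 := h2 0; rewrite mulr0 add0r dt1 mulr1 in h3.
apply: is_derive_pos_right h3 _ _; first by rewrite -expr2 exprn_even_gt0.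
by rewrite mulr0 add0r det3E; ring.
Qed.

(** Otherwise [y t] lies in the tangent plane at [s] on a ray other than that of [y s]. The boundary
    curve, leaving [y s] towards [y t], then enters the interior of the cone on [y s], [y t] and any
    third ray off the plane. *)
Lemma tangent_form_gt0 s t : s < t < s + T -> 0 < tangent_form y y1 s t.
Proof.
move=> /andP[st tT]; rewrite lt_def tangent_form_ge0 andbT; apply/negP => /eqP F0.
pose p := y s; pose q := y t.
pose a := det3 (y2 s) (y1 s) q; pose b := det3 (y2 s) q p.
have qE : q = b *: y1 s + a *: p.
  have := det3_basis q (dt1 s); rewrite -/p -/a -/b.
  by move: F0; rewrite /tangent_form -/q -/p => ->; rewrite scale0r add0r.
have q0 : q != 0.
  apply/eqP => q0; have /eqP := dt1 t.
  by rewrite -/q q0 det3_0r eq_sym oner_eq0.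
have p0 : p != 0.
  apply/eqP => p0; have /eqP := dt1 s.
  by rewrite -/p p0 det3_0r eq_sym oner_eq0.
(* If [b] were 0, [q] would be a multiple of [p]: a negative one gives a line in the cone, a
   positive one repeats a ray within a period. *)
have b0 : b != 0.
  apply/eqP => b0; move: qE; rewrite b0 scale0r add0r => qE.
  have [_ [_ [Kz [_ Kp]]]] := lift_cone lift.
  have [a0|a0|a0] := ltgtP a 0.
  - move: p0; rewrite (Kp p) ?eqxx//; first exact: yK.
    have -> : - p = (- a)^-1 *: q.
      by rewrite qE scalerA invrN mulNr mulVf ?lt_eqF// scaleN1r.
    by apply: Kz; [exact: yK|rewrite invr_ge0 oppr_ge0 ltW].
  - apply: (lifts_boundary_inj (lift_period lift) (lift_bdry lift) (s := s) (s' := t) (l := a)) => //.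
    by lra.
  - by move: q0; rewrite qE a0 scale0r eqxx.
have [tau ftau] : exists tau, 0 < tangent_form y y1 s tau.
  have [r r0 H] := tangent_form_pos_near s (oner_neq0 _).
  by exists (1 * (r / 2) + s); apply: H; lra.
pose c := y tau; pose D := det3 p q c.
have DE : D = - b * tangent_form y y1 s tau.
  by rewrite /D qE /tangent_form -/p -/c !det3E !mxE; ring.
(* The speed [b] makes the initial velocity equal to [q] up to a multiple of [p], so the coordinate
   along [q] becomes positive for either sign of [b]. *)
pose w e := y (b * e + s).
have dw : der w (fun e => b *: y1 (b * e + s)) by exact: der_row_comp_affine.
have w0 : w 0 = p by rewrite /w mulr0 add0r.
have f0 := ftau; set f := tangent_form y y1 s tau in f0 DE.
have D2 : 0 < D * D by rewrite -expr2 DE exprn_even_gt0//= mulf_neq0 ?oppr_eq0// gt_eqF.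
have G1 : exists2 r : R, 0 < r & forall e, 0 < e < r -> 0 < det3 (w e) q c * D.
  apply: continuous_pos_right; last by rewrite w0.
  have h : is_derive (0 : R) 1 (fun e => det3 (w e) q c * D)
      (det3 (b *: y1 (b * 0 + s)) q c * D).
    by derive_solve; rewrite !det3E !mxE; ring.
  exact: is_derive_continuous h.
have G2 : exists2 r : R, 0 < r & forall e, 0 < e < r -> 0 < det3 p (w e) c * D.
  have h : is_derive (0 : R) 1 (fun e => det3 p (w e) c * D) (D * D).
    derive_solve; rewrite mulr0 add0r {3}/D qE !det3E !mxE; ring.
  by apply: is_derive_pos_right h D2 _; rewrite w0 det3E; ring.
have G3 : exists2 r : R, 0 < r & forall e, 0 < e < r -> 0 < det3 p q (w e) * D.
  have [r r0 H] := tangent_form_pos_near s b0; exists r => // e /H h.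
  have -> : det3 p q (w e) * D = b ^+ 2 * f * tangent_form y y1 s (b * e + s).
    by rewrite DE qE /tangent_form -/p -/(w e) !det3E !mxE; ring.
  by do 2![apply: mulr_gt0 => //]; rewrite exprn_even_gt0.
have [e [p1 p2 p3]] := common_pos_right G1 G2 G3.
by apply: (@ybd (b * e + s)); apply: (simplicial_cone_interior (lift_cone lift) (yK s) (yK t) (yK tau)).
Qed.

Lemma tangent_form_dual_gt0 s t : s < t < s + T -> 0 < tangent_form y y1 t s.
Proof.
move=> stT; have -> : tangent_form y y1 t s = tangent_form y y1 t (s + T).
  by rewrite /tangent_form; have [-> _] := lift_bdry lift.
by apply: tangent_form_gt0; lra.
Qed.

End tangent_planes.

Definition hill {R : realType} (q v v' : R -> R) : Prop :=
  der v v' /\ der v' (fun t => - q t * v t).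

(** * Logarithmic derivatives at a double zero *)

Section quadratic_zero.
Context {R : realType}.

Lemma derive_eq_on {V : normedModType R} (f g : R -> V) (a b t : R) (d e : V) : a < t < b ->
  (forall s, a < s < b -> f s = g s) ->
  is_derive t 1 f d -> is_derive t 1 g e -> d = e.
Proof.
move=> /andP[at_ tb] fg fd ge; apply: is_derive_uniq ge.
apply: near_eq_is_derive fd; apply/nbhs_ballP.
exists (Num.min (t - a) (b - t)); first by rewrite /= lt_min !subr_gt0 at_.
move=> s; rewrite /ball/= lt_min !ltr_norml => /andP[/andP[h1 h2] /andP[h3 h4]].
by apply: fg; lra.
Qed.

Lemma continuous_at_lipschitz (g : R -> R) (a r C : R) : 0 < r -> g a = 0 ->
  (forall t, `|t - a| < r -> `|g t| <= C * `|t - a|) -> {for a, continuous g}.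
Proof.
move=> r0 ga H; apply/continuous_nearP => e e0; rewrite ga.
have C0 : 0 < `|C| + 1 by rewrite ltr_wpDl.
exists (Num.min r (e / (`|C| + 1))); first by rewrite lt_min r0 divr_gt0.
move=> t; rewrite lt_min subr0 => /andP[/H h te]; apply: (le_lt_trans h).
have h2 : (`|C| + 1) * `|t - a| < e by rewrite mulrC -ltr_pdivlMr.
apply: le_lt_trans h2; apply: ler_wpM2r => //.
by have := ler_norm C; lra.
Qed.

(** The logarithmic derivative of [phi] has a simple pole at the double zero [a], and v^2 vanishes
    there to second order, so the product is O(|t - a|). The value at [a] itself is 0 because
    [v a = 0]. *)
Lemma continuous_sq_log_derivative (phi phi' v : R -> R) (a d e : R) :
  der phi phi' -> is_derive a 1 phi' d -> 0 < d -> phi a = 0 -> phi' a = 0 ->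
  is_derive a 1 v e -> v a = 0 ->
  {for a, continuous (fun t => v t ^+ 2 * (phi' t / phi t))}.
Proof.
move=> pp p'd d0 pa p'a vd va.
have d2 : d / 2 < d by lra.
have [r1 r10 H1] := is_derive_slope_gt p'd d2.
have [r2 r20 H2] := is_derive_lipschitz p'd.
have [r3 r30 H3] := is_derive_lipschitz vd.
have low t : `|t - a| < r1 -> d / 4 * (t - a) ^+ 2 <= phi t.
  move=> tr; rewrite -subr_ge0.
  pose g t := phi t - d / 4 * (t - a) ^+ 2.
  have gd : der g (fun t => phi' t - d / 2 * (t - a)).
    by move=> s; rewrite /g; derive_solve; field.
  have ga : g a = 0 by rewrite /g pa subrr; ring.
  rewrite -/(g t); have gc := der_continuous gd.
  have [at_|ta] := leP a t.
    rewrite -ga; apply: (derive_ge0_le at_ (fun s _ => gd s) (fun s _ => gc s)) => s /andP[as_ st].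
    have sa : 0 < s - a by lra.
    have := H1 s; rewrite p'a subr0 gtr0_norm// => h.
    have : d / 2 * (s - a) ^+ 2 <= phi' s * (s - a).
      by apply: h; move: tr; rewrite ger0_norm; lra.
    by rewrite expr2 mulrA ler_pM2r// subr_ge0.
  pose k s := - g s.
  have kd : der k (fun t => - (phi' t - d / 2 * (t - a))) by move=> s; rewrite /k; derive_solve.
  have kc := der_continuous kd.
  suff : k t <= k a by rewrite /k ga; lra.
  apply: (derive_ge0_le (ltW ta) (fun s _ => kd s) (fun s _ => kc s)) => s /andP[ts sa].
  have sa' : s - a < 0 by lra.
  have := H1 s; rewrite p'a subr0 ltr0_norm// => h.
  have : d / 2 * (s - a) ^+ 2 <= phi' s * (s - a).
    by apply: h; move: tr; rewrite ltr0_norm; lra.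
  by rewrite expr2 mulrA ler_nM2r//; lra.
pose L1 := `|d| + 1; pose L2 := `|e| + 1.
have L10 : 0 <= L1 by rewrite addr_ge0.
have L20 : 0 <= L2 by rewrite addr_ge0.
apply: (@continuous_at_lipschitz _ _ (Num.min r1 (Num.min r2 r3)) (L2 * L2 * L1 * (4 / d))).
- by rewrite !lt_min r10 r20.
- by rewrite va; ring.
move=> t; rewrite !lt_min => /andP[t1 /andP[t2 t3]].
have h1 := low t t1.
have h2 := H2 t t2; rewrite p'a subr0 -/L1 in h2.
have h3 := H3 t t3; rewrite va subr0 -/L2 in h3.
have [->|ta] := eqVneq t a; first by rewrite va subrr normr0 !mulr0 expr2 mul0r mul0r normr0.
have u0 : 0 < `|t - a| by rewrite normr_gt0 subr_eq0.
have low' : d / 4 * `|t - a| ^+ 2 <= phi t by rewrite real_normK ?num_real.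
have pos : 0 < d / 4 * `|t - a| ^+ 2 by rewrite mulr_gt0 ?exprn_gt0//; lra.
have p0 : 0 < phi t by exact: lt_le_trans low'.
rewrite normrM normrX (normrM (phi' t)) normfV (gtr0_norm p0) mulrA ler_pdivrMr//.
apply: (@le_trans _ _ ((L2 * `|t - a|) ^+ 2 * (L1 * `|t - a|))).
  by apply: ler_pM => //; rewrite ?sqr_ge0 ?exprn_ge0//; apply: lerXn2r; rewrite ?nnegrE// mulr_ge0.
have -> : (L2 * `|t - a|) ^+ 2 * (L1 * `|t - a|) =
   L2 * L2 * L1 * (4 / d) * `|t - a| * (d / 4 * `|t - a| ^+ 2) by field; rewrite gt_eqF.
by apply: ler_wpM2l => //; rewrite !mulr_ge0// invr_ge0 ltW.
Qed.

End quadratic_zero.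

(** * Sturm comparison of Hill's equation with the curve and its dual *)

Section sturm.
Context {R : realType} {K : set (vec3 R)} {T : R} {y y1 y2 y3 : R -> vec3 R}.
Context {al de : R -> R}.

Hypothesis lift : normalized_lift K T y y1 y2 y3.
Hypothesis ode : forall t, y3 t = - (2 * al t) *: y1 t - de t *: y t.

Let d1 : der y y1 := lift_der1 lift.
Let d2 : der y1 y2 := lift_der2 lift.
Let d3 : der y2 y3 := lift_der3 lift.
Let dt1 : forall t, det3 (y2 t) (y1 t) (y t) = 1 := lift_det lift.
Let q t : R := al t / 2.
Let T0 : 0 < T := lift_period lift.

Let f s t : R := tangent_form y y1 s t.
Let f1 s t : R := det3 (y1 t) (y1 s) (y s).
Let f2 s t : R := det3 (y2 t) (y1 s) (y s).
Let f3 s t : R := det3 (y3 t) (y1 s) (y s).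
Let h s t : R := tangent_form y y1 t s.
Let h1 s t : R := det3 (y s) (y2 t) (y t).
Let h2 s t : R := det3 (y s) (y3 t) (y t) + det3 (y s) (y2 t) (y1 t).

Let fd1 s : der (f s) (f1 s). Proof. exact: tangent_form_der lift s. Qed.
Let fd2 s : der (f1 s) (f2 s). Proof. exact: tangent_form_der2 lift s. Qed.
Let fd3 s : der (f2 s) (f3 s).
Proof. by move=> t; rewrite /f2 /f3; derive_solve; rewrite !det3E !mxE; ring. Qed.
Let hd1 s : der (h s) (h1 s).
Proof. by move=> t; rewrite /h /tangent_form /h1; derive_solve; rewrite !det3E !mxE; ring. Qed.
Let hd2 s : der (h1 s) (h2 s).
Proof. by move=> t; rewrite /h1 /h2; derive_solve; rewrite !det3E !mxE; ring. Qed.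

(* The flags (point, tangent plane) at [s] and [t] being incident with themselves
   gives one bilinear relation between a curve and its dual. *)
Lemma tangent_duality s t :
  f2 s t * h s t - f1 s t * h1 s t + f s t * (h2 s t + 2 * al t * h s t) = 0.
Proof.
rewrite /f2 /h /f1 /h1 /f /h2 /tangent_form ode !det3E !mxE; ring.
Qed.

(** The logarithmic derivative of (f h)^(1/4). *)
Let sigma s t : R := (f1 s t / f s t + h1 s t / h s t) / 4.
Let theta s (v v' : R -> R) t : R := v t * v' t - sigma s t * v t ^+ 2.
Let theta' s (v v' : R -> R) t : R := (v' t - sigma s t * v t) ^+ 2 +
  3 / 16 * (f1 s t / f s t - h1 s t / h s t) ^+ 2 * v t ^+ 2.

Let theta_der s v v' t : hill q v v' -> s < t < s + T ->
  is_derive t 1 (theta s v v') (theta' s v v' t).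
Proof.
move=> [vd v'd] stT.
have f0 : f s t != 0 by rewrite gt_eqF// (tangent_form_gt0 lift).
have h0 : h s t != 0 by rewrite gt_eqF// (tangent_form_dual_gt0 lift).
have F1 := fd1 s; have F2 := fd2 s; have H1 := hd1 s; have H2 := hd2 s.
have rel := tangent_duality s t.
rewrite /theta /sigma; derive_solve; [exact: f0|exact: h0|].
rewrite /theta' /sigma.
(* Duality gives f''/f + h''/h = f' h' / (f h) - 2 al. Since 4 q = 2 al, the potential cancels and
   the rest completes to two squares. *)
have h2E : h2 s t = (f1 s t * h1 s t - f2 s t * h s t) / f s t - 2 * al t * h s t.
  apply: (mulfI f0); rewrite mulrBr mulrCA divff// mulr1; move: rel; rewrite mulrDr; lra.
rewrite h2E /q; field; exact/andP.
Qed.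

Let theta'_ge0 s v v' t : 0 <= theta' s v v' t.
Proof.
apply: addr_ge0; first exact: sqr_ge0.
by apply: mulr_ge0; [apply: mulr_ge0; [lra|]|]; exact: sqr_ge0.
Qed.

(** At a zero of [v] the function [theta] vanishes and has derivative v'^2. If this is positive at
    [t1], then [theta], being nondecreasing, cannot be back at 0 at [t2]. *)
Lemma hill_zeros_apart s v v' t1 t2 : hill q v v' -> s < t1 -> t1 < t2 -> t2 < s + T ->
  v t1 = 0 -> v t2 = 0 -> v' t1 = 0.
Proof.
move=> vh st1 t12 t2T v1 v2; apply/eqP/negPn/negP => v'0.
have th0 t : v t = 0 -> theta s v v' t = 0 by move=> vt; rewrite /theta vt; ring.
have D t : t1 <= t <= t2 -> is_derive t 1 (theta s v v') (theta' s v v' t).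
  by move=> tt; apply: theta_der => //; lra.
have D1 : is_derive t1 1 (theta s v v') (v' t1 ^+ 2).
  apply: is_derive_ext (D t1 _) _; first by lra.
  by rewrite /theta' v1; ring.
have v2pos : 0 < v' t1 ^+ 2 by rewrite exprn_even_gt0.
have [r r0 [H _]] := is_derive_gt0_near D1 v2pos (th0 _ v1).
pose t := t1 + Num.min r (t2 - t1) / 2.
have m0 : 0 < Num.min r (t2 - t1) by rewrite lt_min r0 subr_gt0.
have mr : Num.min r (t2 - t1) <= r by rewrite ge_min lexx.
have mt : Num.min r (t2 - t1) <= t2 - t1 by rewrite ge_min lexx orbT.
have tt : t1 < t < t2 by rewrite /t; lra.
have : 0 < theta s v v' t by apply: H; rewrite /t; lra.
suff : theta s v v' t <= theta s v v' t2 by rewrite (th0 _ v2); lra.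
apply: (@derive_ge0_le _ _ (theta' s v v')); first by lra.
- by move=> u uu; apply: D; lra.
- by move=> u uu; apply: is_derive_continuous (D u _); lra.
- by move=> u _; exact: theta'_ge0.
Qed.

Lemma hill_no_zero s v v' t : hill q v v' -> v s = 0 -> v' s != 0 ->
  s < t < s + T -> v t != 0.
Proof.
move=> vh vs v's /andP[st tT]; apply/eqP => vt; move: v's => /eqP; apply.
(* [theta] is singular at its base point, so this point is moved left by half of the slack; both
   zeros are then strictly inside one period. *)
by apply: (@hill_zeros_apart (s - (s + T - t) / 2) v v' s t) => //; lra.
Qed.

Let per (g g' : R -> vec3 R) : der g g' -> periodic T g -> periodic T g'.
Proof. exact: der_row_periodic. Qed.
Let p0 : periodic T y := (lift_bdry lift).1.
Let p1 : periodic T y1 := per d1 p0.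
Let p2 : periodic T y2 := per d2 p1.

(** Equality case of the comparison: [theta] is nondecreasing and 0 at both ends of the period,
    hence identically 0. Then [f] is proportional to u^2, and comparing the third-order equations of
    [f] and u^2 isolates [de - al']. *)
Lemma hill_rigidity s u u' al' : der al al' -> hill q u u' ->
  u s = 0 -> u' s != 0 -> u (s + T) = 0 ->
  forall t, s < t < s + T -> de t = al' t.
Proof.
move=> ald uh us u's uT; have [ud u'd] := uh.
have F1 := fd1 s; have F2 := fd2 s; have F3 := fd3 s; have H1 := hd1 s; have H2 := hd2 s.
have uc := der_continuous ud; have u'c := der_continuous u'd.
(* At both ends [f] and [h] have a double zero, which the factor u^2 compensates. *)
have thc a : u a = 0 -> f s a = 0 -> f1 s a = 0 -> f2 s a = 1 ->
    h s a = 0 -> h1 s a = 0 -> h2 s a = 1 -> {for a, continuous (theta s u u')}.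
  move=> ua fa f1a f2a ha h1a h2a.
  have F2a := F2 a; rewrite f2a in F2a; have H2a := H2 a; rewrite h2a in H2a.
  have c1 := continuous_sq_log_derivative F1 F2a ltr01 fa f1a (ud a) ua.
  have c2 := continuous_sq_log_derivative H1 H2a ltr01 ha h1a (ud a) ua.
  have -> : theta s u u' = (fun t => u t * u' t - (u t ^+ 2 * (f1 s t / f s t) +
      u t ^+ 2 * (h1 s t / h s t)) * 4^-1).
    by apply/funext => t; rewrite /theta /sigma; ring.
  apply: cvgB; first exact: cvgM (uc a) (u'c a).
  by apply: cvgM; [exact: cvgD c1 c2|exact: cvg_cst].
have ats (a : R) : u a = 0 -> y a = y s -> y1 a = y1 s -> y2 a = y2 s ->
    {for a, continuous (theta s u u')}.
  move=> ua e0 e1 e2; have := dt1 s => dd; apply: thc => //.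
  - by rewrite /f /tangent_form e0 det3E; ring.
  - by rewrite /f1 e1 det3E; ring.
  - by rewrite /f2 e2.
  - by rewrite /h /tangent_form e0 det3E; ring.
  - by rewrite /h1 e0 det3E; ring.
  - by rewrite /h2 e0 e1 e2 -dd !det3E; ring.
have th0 a : u a = 0 -> theta s u u' a = 0 by move=> ua; rewrite /theta ua; ring.
have D t : s < t < s + T -> is_derive t 1 (theta s u u') (theta' s u u' t).
  exact: theta_der.
have cont t : s <= t <= s + T -> {for t, continuous (theta s u u')}.
  move=> /andP[st tT].
  have [E|st'] := eqVneq t s; first by rewrite E; exact: ats.
  have [E|tT'] := eqVneq t (s + T); first by rewrite E; apply: ats => //; rewrite ?p0 ?p1 ?p2.
  by apply: is_derive_continuous (D t _); rewrite lt_def st' st/= lt_neqAle tT' tT.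
have theta0 t : s < t < s + T -> theta s u u' t = 0.
  move=> /andP[st tT]; apply/eqP; rewrite eq_le; apply/andP; split.
    rewrite -(th0 _ uT); apply: (@derive_ge0_le _ _ (theta' s u u')).
    - exact: ltW.
    - by move=> r rr; apply: D; lra.
    - by move=> r rr; apply: cont; lra.
    - by move=> r _; exact: theta'_ge0.
  rewrite -(th0 _ us); apply: (@derive_ge0_le _ _ (theta' s u u')).
  - exact: ltW.
  - by move=> r rr; apply: D; lra.
  - by move=> r rr; apply: cont; lra.
  - by move=> r _; exact: theta'_ge0.
(* Both squares in [theta'] vanish: f'/f = h'/h, and u'/u is half of it. Differentiating this
   relation twice brings in [al']. *)
have E1 t : s < t < s + T -> f1 s t * u t = 2 * f s t * u' t.
  move=> stT.
  have th'0 : theta' s u u' t = 0.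
    by apply: (derive_eq_on stT theta0 (D t stT)); exact: is_derive_const.
  have f0 : f s t != 0 by rewrite gt_eqF// (tangent_form_gt0 lift).
  have h0 : h s t != 0 by rewrite gt_eqF// (tangent_form_dual_gt0 lift).
  have ut := hill_no_zero uh us u's stT.
  have g0 : 0 <= 3 / 16 * (f1 s t / f s t - h1 s t / h s t) ^+ 2 * u t ^+ 2.
    by apply: mulr_ge0; [apply: mulr_ge0; [lra|]|]; exact: sqr_ge0.
  move/eqP: th'0; rewrite paddr_eq0 ?sqr_ge0//.
  have c0 : 3 / 16 != 0 :> R by rewrite mulf_neq0 ?invr_eq0 ?pnatr_eq0.
  rewrite sqrf_eq0 mulf_eq0 sqrf_eq0 (negbTE ut) orbF mulf_eq0 sqrf_eq0 (negbTE c0)/=.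
  rewrite [X in _ && X]subr_eq0 => /andP[/eqP A /eqP B].
  move: A; rewrite /sigma -B => A.
  have -> : u' t = (f1 s t / f s t + f1 s t / f s t) / 4 * u t by lra.
  by field.
have E2 t : s < t < s + T -> f2 s t * u t = f1 s t * u' t - 2 * q t * f s t * u t.
  move=> stT.
  have A : is_derive t 1 (fun r => f1 s r * u r) (f2 s t * u t + f1 s t * u' t).
    by derive_solve.
  have B : is_derive t 1 (fun r => 2 * f s r * u' r)
      (2 * f1 s t * u' t - 2 * f s t * q t * u t) by derive_solve; ring.
  have := derive_eq_on stT E1 A B; lra.
have qd : der q (fun t => al' t / 2) by move=> t; rewrite /q; derive_solve; field.
move=> t stT; have e1 := E1 t stT; have e2 := E2 t stT.
have A : is_derive t 1 (fun r => f2 s r * u r) (f3 s t * u t + f2 s t * u' t).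
  by derive_solve.
have B : is_derive t 1 (fun r => f1 s r * u' r - 2 * q r * f s r * u r)
   (f2 s t * u' t - f1 s t * q t * u t - al' t * f s t * u t
    - 2 * q t * f1 s t * u t - 2 * q t * f s t * u' t).
  by derive_solve; field.
have e3 := derive_eq_on stT E2 A B.
have f3E : f3 s t = - (2 * al t) * f1 s t - de t * f s t.
  by rewrite /f3 /f1 /f /tangent_form ode !det3E !mxE; ring.
have fu : f s t * u t != 0.
  apply: mulf_neq0; last exact: hill_no_zero uh us u's stT.
  by rewrite gt_eqF// (tangent_form_gt0 lift).
apply: (mulIf fu).
have qE : al t = 2 * q t by rewrite /q; field.
rewrite f3E qE in e3.
have k1 : q t * (f1 s t * u t) = q t * (2 * f s t * u' t) by rewrite e1.
lra.
Qed.

(** By rigidity the equation of the curve is the symmetric square of Hill's equation, so v^2 solves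
    it. It is then a fixed linear form evaluated on [y], and inherits the period of [y]. *)
Lemma hill_monodromy s u u' al' v v' : der al al' -> hill q u u' ->
  u s = 0 -> u' s != 0 -> u (s + T) = 0 -> hill q v v' ->
  v (s + T) ^+ 2 = v s ^+ 2 /\ v (s + T) * v' (s + T) = v s * v' s.
Proof.
move=> ald uh us u's uT [vd v'd].
have rig := hill_rigidity ald uh us u's uT.
pose p t := v t ^+ 2; pose p_1 t := 2 * v t * v' t.
pose p_2 t := 2 * (v' t ^+ 2 - q t * v t ^+ 2).
pose p_3 t := - (2 * al t) * p_1 t - al' t * p t.
have qd : der q (fun t => al' t / 2) by move=> t; rewrite /q; derive_solve; field.
have pd1 : der p p_1 by move=> t; rewrite /p /p_1; derive_solve; ring.
have pd2 : der p_1 p_2 by move=> t; rewrite /p_1 /p_2; derive_solve; ring.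
have pd3 : der p_2 p_3.
  by move=> t; rewrite /p_2 /p_3 /p_1 /p; derive_solve; rewrite /q /p_1; field.
(* By Cramer's rule this is the value at [w] of the linear form that takes the values p, p', p'' on
   y, y', y''. It does not depend on [t] where [p] and [y] solve the same equation. *)
pose c w t := p_2 t * det3 w (y1 t) (y t) + p_1 t * det3 (y2 t) w (y t) +
  p t * det3 (y2 t) (y1 t) w.
pose c' w t := p_3 t * det3 w (y1 t) (y t) + p_1 t * det3 (y3 t) w (y t) +
  p t * det3 (y3 t) (y1 t) w.
have cd w : der (c w) (c' w).
  by move=> t; rewrite /c /c'; derive_solve; rewrite !det3E !mxE; ring.
have cE w : c w s = c w (s + T).
  apply: (@derive_eq0_eq _ _ (c' w)); first by rewrite lerDl ltW.
  - by move=> t _; exact: cd.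
  - by move=> t _; exact: der_continuous (cd w) t.
  move=> t /rig de_al; rewrite /c' /p_3 ode de_al !det3E !mxE; ring.
have dd := dt1 s.
have := cE (y s); have := cE (y1 s).
rewrite /c p0 p1 p2 dd.
have z1 : det3 (y1 s) (y1 s) (y s) = 0 by rewrite det3E; ring.
have z2 : det3 (y2 s) (y1 s) (y1 s) = 0 by rewrite det3E; ring.
have z3 : det3 (y s) (y1 s) (y s) = 0 by rewrite det3E; ring.
have z4 : det3 (y2 s) (y s) (y s) = 0 by rewrite det3E; ring.
rewrite z1 z2 z3 z4 !mulr0 !mulr1 !add0r !addr0 /p_1 /p => h_1 h_0.
by split; [rewrite h_0|lra].
Qed.

End sturm.

(** * Solutions of Hill's equation and their quadratic forms *)

Section hill_equation.
Context {R : realType} {q : R -> R}.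

Lemma hill_wronskian v v' w w' : hill q v v' -> hill q w w' ->
  forall s t, v s * w' s - w s * v' s = v t * w' t - w t * v' t.
Proof.
move=> [vd v'd] [wd w'd].
apply: (@der0_const _ (fun t => v t * w' t - w t * v' t)) => t.
by derive_solve; ring.
Qed.

Lemma hill_lin v v' w w' (a b : R) : hill q v v' -> hill q w w' ->
  hill q (fun t => a * v t + b * w t) (fun t => a * v' t + b * w' t).
Proof. by move=> [vd v'd] [wd w'd]; split=> t; derive_solve; ring. Qed.

Lemma hill_shift (T : R) v v' : periodic T q -> hill q v v' ->
  hill q (fun t => v (t + T)) (fun t => v' (t + T)).
Proof.
move=> qT [vd v'd]; split=> t.
  have := der_comp_affine 1 T vd t.
  by under eq_fun do rewrite mul1r; rewrite !mul1r.
have := der_comp_affine 1 T v'd t.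
by under eq_fun do rewrite mul1r; rewrite !mul1r qT.
Qed.

(** The constancy of the Wronskians takes the place of a uniqueness theorem for initial values. *)
Lemma hill_decomp (s : R) v v' w w' x x' : hill q v v' -> hill q w w' ->
  v s = 1 -> v' s = 0 -> w s = 0 -> w' s = 1 -> hill q x x' ->
  forall t, x t = x s * v t + x' s * w t.
Proof.
move=> vh wh vs v's ws w's xh t.
have A := hill_wronskian xh wh s t; have B := hill_wronskian vh xh s t.
have C := hill_wronskian vh wh s t.
rewrite !(vs, v's, ws, w's) in A B C.
have W1 : v t * w' t - w t * v' t = 1 by rewrite -C; ring.
have -> : x s = x t * w' t - w t * x' t by rewrite -A; ring.
have -> : x' s = v t * x' t - x t * v' t by rewrite -B; ring.
by rewrite -[LHS]mulr1 -W1; ring.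
Qed.

Lemma hill_Cn n v v' : Cn n q -> hill q v v' -> Cn n.+2 v.
Proof.
move=> Cq [vd v'd]; apply: (Cn_der vd); apply: (Cn_der v'd); elim: n Cq => [|n ih] Cq.
  by apply: (Cn_mul (Cn_opp Cq)); apply/Cn0; exact: der_continuous vd.
apply: (Cn_mul (Cn_opp Cq)); apply: Cn_pred; apply: (Cn_der vd); apply: (Cn_der v'd).
exact: ih (Cn_pred Cq).
Qed.

(** The right-hand side is minus the discriminant of the form, times the square of the Wronskian,
    which is 1. Up to a scaling it becomes twice the constant alpha. *)
Lemma hill_quadratic_form v v' w w' (a b c : R) : hill q v v' -> hill q w w' ->
  (forall t, v t * w' t - w t * v' t = 1) ->
  let rho t := a * v t ^+ 2 + b * (v t * w t) + c * w t ^+ 2 in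
  exists rho1 rho2 : R -> R, [/\ der rho rho1, der rho1 rho2,
    (forall t, 2 * rho t * rho2 t - rho1 t ^+ 2 + 4 * q t * rho t ^+ 2 = 4 * a * c - b ^+ 2) &
    forall n, Cn n q -> Cn n.+2 rho].
Proof.
move=> vh wh W1 rho; have [vd v'd] := vh; have [wd w'd] := wh.
pose rho1 t := 2 * a * (v t * v' t) + b * (v' t * w t + v t * w' t) + 2 * c * (w t * w' t).
pose rho2 t := 2 * a * (v' t ^+ 2 - q t * v t ^+ 2) + 2 * b * (v' t * w' t - q t * (v t * w t))
  + 2 * c * (w' t ^+ 2 - q t * w t ^+ 2).
exists rho1, rho2; split.
- by move=> t; rewrite /rho /rho1; derive_solve; ring.
- by move=> t; rewrite /rho1 /rho2; derive_solve; ring.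
- move=> t; have -> : 4 * a * c - b ^+ 2 =
    (4 * a * c - b ^+ 2) * (v t * w' t - w t * v' t) ^+ 2 by rewrite W1; ring.
  by rewrite /rho /rho1 /rho2; ring.
- move=> n Cq; have Cv := hill_Cn Cq vh; have Cw := hill_Cn Cq wh.
  rewrite /rho; under eq_fun do rewrite !expr2.
  repeat Cn_step.
Qed.

End hill_equation.

(** * A positive density invariant under the monodromy *)

Section invariant_density.
Context {R : realType} {K : set (vec3 R)} {T : R} {y y1 y2 y3 : R -> vec3 R}.
Context {al de : R -> R}.

(* [rho] is a quadratic form in the solutions [V] of Hill's equation invariant under the
   monodromy [M]: either [det (V, M V)], which is nonnegative, or, if that form vanishes
   somewhere, [M = 1] or [M = -1] by rigidity and any positive definite form will do. *)
Lemma invariant_density al' : normalized_lift K T y y1 y2 y3 ->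
  (forall t, y3 t = - (2 * al t) *: y1 t - de t *: y t) ->
  der al al' -> periodic T al ->
  exists (rho rho1 rho2 : R -> R) (c : R), [/\ der rho rho1, der rho1 rho2,
    forall t, 0 < rho t, periodic T rho &
    (forall t, 2 * rho t * rho2 t - rho1 t ^+ 2 + 2 * al t * rho t ^+ 2 = c) /\
    forall n, Cn n al -> Cn n.+2 rho].
Proof.
move=> lift ode ald alT; have T0 := lift_period lift.
pose q t := al t / 2.
have qd : der q (fun t => al' t / 2) by move=> t; rewrite /q; derive_solve; field.
have qc := der_continuous qd.
have qT : periodic T q by move=> t; rewrite /q alT.
have qCn n : Cn n al -> Cn n q by move=> Ca; rewrite /q; repeat Cn_step.
have qE t : 4 * q t = 2 * al t by rewrite /q; field.
have [v [v' [vd v'd v0 v'0]]] := hill_exists 1 0 qc.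
have [w [w' [wd w'd w0 w'0]]] := hill_exists 0 1 qc.
have vh : hill q v v' by split.
have wh : hill q w w' by split.
have W1 t : v t * w' t - w t * v' t = 1.
  by rewrite -(hill_wronskian vh wh 0 t) v0 w0 v'0 w'0; ring.
(* [u s] is the solution vanishing at [s] with slope 1. Its value at [s + T] is the invariant form
   det (V, M V) at [s], so the absence of zeros in a period gives its sign. *)
pose u s t := (- w s) * v t + v s * w t; pose u' s t := (- w s) * v' t + v s * w' t.
have uh s : hill q (u s) (u' s) by exact: hill_lin.
have us s : u s s = 0 by rewrite /u; ring.
have u's s : u' s s = 1 by rewrite /u' -(W1 s); ring.
have u's0 s : u' s s != 0 by rewrite u's oner_neq0.
have uc s : continuous (u s) by exact: der_continuous (uh s).1.
have uT_ge0 s : 0 <= u s (s + T).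
  rewrite leNgt; apply/negP => neg.
  have us1 : is_derive s 1 (u s) 1.
    exact: is_derive_ext ((uh s).1 s) (u's s).
  have [r r0 [H _]] := is_derive_gt0_near us1 ltr01 (us s).
  pose e := Num.min r T / 2.
  have m0 : 0 < Num.min r T by rewrite lt_min r0.
  have mr : Num.min r T <= r by rewrite ge_min lexx.
  have mT : Num.min r T <= T by rewrite ge_min lexx orbT.
  have pos : 0 < u s (s + e) by apply: H; rewrite /e; lra.
  have eT : s + e <= s + T by rewrite /e; lra.
  have uw : {within `[s + e, s + T], continuous (u s)}.
    by apply: within_continuous => t _; exact: uc.
  have u0 : Num.min (u s (s + e)) (u s (s + T)) <= 0 <= Num.max (u s (s + e)) (u s (s + T)).
    by rewrite ge_min le_max (ltW neg) (ltW pos) orbT.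
  have [c] := IVT eT uw u0.
  rewrite in_itv/= => /andP[ce cT] uc0.
  have stc : s < c < s + T.
    have [E|ne] := eqVneq c (s + T); first by move: neg; rewrite -E uc0 ltxx.
    by move: cT; rewrite le_eqVlt (negbTE ne)/= => cT; rewrite /e in ce *; lra.
  by have := hill_no_zero lift ode (uh s) (us s) (u's0 s) stc; rewrite uc0 eqxx.
have vT := hill_shift qT vh; have wT := hill_shift qT wh.
pose A := v T; pose B := v' T; pose C := w T; pose D := w' T.
have vTE t : v (t + T) = A * v t + B * w t.
  by rewrite (hill_decomp vh wh v0 v'0 w0 w'0 vT t) !add0r.
have wTE t : w (t + T) = C * v t + D * w t.
  by rewrite (hill_decomp vh wh v0 v'0 w0 w'0 wT t) !add0r.
have ABCD : A * D - B * C = 1 by rewrite -(W1 T) /A /B /C /D; ring.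
have [nz|] := pselect (forall s, u s (s + T) != 0).
  (* The coefficients come from expanding v (C v + D w) - w (A v + B w). *)
  have [rho1 [rho2 [rd1 rd2 rE rC]]] := hill_quadratic_form C (D - A) (- B) vh wh W1.
  pose rho t := C * v t ^+ 2 + (D - A) * (v t * w t) + - B * w t ^+ 2.
  exists rho, rho1, rho2, (4 * C * - B - (D - A) ^+ 2); split => //.
  - move=> t; have -> : rho t = u t (t + T) by rewrite /rho /u vTE wTE; ring.
    by rewrite lt_def nz uT_ge0.
  - move=> t; rewrite /rho vTE wTE.
    transitivity ((A * D - B * C) * rho t); first by rewrite /rho; ring.
    by rewrite ABCD mul1r.
  - by split=> [t|n /qCn/rC//]; rewrite -qE; exact: rE.
move=> /existsNP[s /negP]; rewrite negbK => /eqP usT.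
(* [z] completes [u s] to the basis of solutions with unit initial data at [s]. There the monodromy
   turns out to be the scalar [z (s + T)], which is 1 or -1. *)
pose z t := w' s * v t + (- v' s) * w t; pose z' t := w' s * v' t + (- v' s) * w' t.
have zh : hill q z z' by exact: hill_lin.
have zs : z s = 1 by rewrite /z -(W1 s); ring.
have z's : z' s = 0 by rewrite /z'; ring.
have [zT zz'T] := hill_monodromy lift ode ald (uh s) (us s) (u's0 s) usT zh.
rewrite zs z's expr1n mulr0 in zT zz'T.
have zT0 : z (s + T) != 0 by rewrite -sqrf_eq0 zT oner_neq0.
have z'T : z' (s + T) = 0 by move/eqP: zz'T; rewrite mulf_eq0 (negbTE zT0) => /eqP.
have WT : z (s + T) * u' s (s + T) = 1.
  have := hill_wronskian zh (uh s) s (s + T).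
  by rewrite zs z's us u's usT z'T; lra.
have u'T : u' s (s + T) = z (s + T).
  by apply: (mulfI zT0); rewrite WT -expr2 zT.
have sq x x' : hill q x x' -> forall t, x (t + T) ^+ 2 = x t ^+ 2.
  move=> xh t.
  have xT := hill_decomp zh (uh s) zs z's (us s) (u's s) (hill_shift qT xh) t.
  have x0 := hill_decomp zh (uh s) zs z's (us s) (u's s) xh.
  have x0' : x' (s + T) = x' s * z (s + T).
    have := hill_wronskian zh xh s (s + T); rewrite zs z's z'T => h.
    have {}h : x' s = z (s + T) * x' (s + T) by rewrite -[LHS]mul1r; lra.
    by rewrite h mulrAC -expr2 zT mul1r.
  rewrite xT (x0 (s + T)) usT mulr0 addr0 x0'.
  have -> : x s * z (s + T) * z t + x' s * z (s + T) * u s t = z (s + T) * x t.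
    by rewrite (x0 t); ring.
  by rewrite exprMn zT mul1r.
have [rho1 [rho2 [rd1 rd2 rE rC]]] := hill_quadratic_form 1 0 1 vh wh W1.
pose rho t := 1 * v t ^+ 2 + 0 * (v t * w t) + 1 * w t ^+ 2.
exists rho, rho1, rho2, (4 * 1 * 1 - 0 ^+ 2); split => //.
- move=> t; have -> : rho t = v t ^+ 2 + w t ^+ 2 by rewrite /rho; ring.
  rewrite lt_def addr_ge0 ?sqr_ge0// andbT paddr_eq0 ?sqr_ge0// !sqrf_eq0.
  apply/negP => /andP[/eqP v0' /eqP w0'].
  by have := W1 t; rewrite v0' w0' !mul0r subrr => /esym/eqP; rewrite oner_eq0.
- by move=> t; rewrite /rho (sq _ _ vh) (sq _ _ wh) !mul0r.
- by split=> [t|n /qCn/rC//]; rewrite -qE; exact: rE.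
Qed.

End invariant_density.

(** * Rescaling and reparametrizing lifts of the boundary *)

Section reparametrization.
Context {R : realType}.
Implicit Types (K : set (vec3 R)) (x : R -> vec3 R).

Lemma lifts_boundary_scale K T x (m : R -> R) : (forall t, 0 < m t) -> periodic T m ->
  lifts_boundary K T x -> lifts_boundary K T (fun t => m t *: x t).
Proof.
move=> m0 mT [xT [bd inj]]; split; first by move=> t; rewrite mT xT.
split=> [p|s s' s0 s'0 [l [l0 E]]].
  rewrite bd; split=> -[l [s [l0 ->]]].
    exists (l / m s), s; rewrite divr_gt0//; split => //.
    by rewrite scalerA divfK// gt_eqF.
  by exists (l * m s), s; rewrite mulr_gt0//; split => //; rewrite scalerA.
apply: inj => //; exists (l * m s / m s'); rewrite !mulr_gt0 ?invr_gt0//; split => //.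
have -> : x s' = (m s')^-1 *: (m s' *: x s') by rewrite scalerA mulVf ?scale1r// gt_eqF.
by rewrite E !scalerA; congr (_ *: _); ring.
Qed.

Lemma lifts_boundary_opp K T x : 0 < T -> lifts_boundary K T x ->
  lifts_boundary K T (fun t => x (- t)).
Proof.
move=> T0 H; have [xT [bd _]] := H.
have xN t : x (t - T) = x t by rewrite -(xT (t - T)) subrK.
split; first by move=> t; rewrite opprD xN.
split=> [p|s s' s0 s'0 [l [l0 E]]].
  rewrite bd; split=> -[l [s [l0 ->]]]; exists l, (- s); rewrite ?opprK//.
have inj := lifts_boundary_inj T0 H.
have [ss|ss|//] := ltgtP s s'.
  exfalso; apply: (inj (- s') (- s) l^-1); rewrite ?invr_gt0//; first by lra.
  by rewrite E scalerA mulVf ?scale1r// gt_eqF.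
by exfalso; apply: (inj (- s) (- s') l) => //; lra.
Qed.

Lemma lifts_boundary_comp K T T' x (phi psi : R -> R) :
  cancel phi psi -> cancel psi phi -> {mono phi : s t / s < t} ->
  phi 0 = 0 -> (forall s, phi (s + T) = phi s + T') ->
  lifts_boundary K T x -> lifts_boundary K T' (fun t => x (psi t)).
Proof.
move=> phiK psiK mono phi0 phiT [xT [bd inj]].
have psiT t : psi (t + T') = psi t + T by rewrite -{1}(psiK t) -phiT phiK.
split; first by move=> t; rewrite psiT xT.
split=> [p|s s' s0 s'0 [l [l0 E]]].
  rewrite bd; split=> -[l [s [l0 ->]]]; first by exists l, (phi s); rewrite phiK.
  by exists l, (psi s).
have rng t : 0 <= t < T' -> 0 <= psi t < T.
  have phiT0 : phi T = T' by rewrite -[T]add0r phiT phi0 add0r.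
  have h1 : (psi t < 0) = (t < 0) by rewrite -[LHS]mono psiK phi0.
  have h2 : (psi t < T) = (t < T') by rewrite -[LHS]mono psiK phiT0.
  by rewrite !leNgt h1 h2.
by rewrite -[s]psiK -[s']psiK; congr phi; apply: inj; [exact: rng|exact: rng|exists l].
Qed.

(** Bootstrap: the regularity already known for [psi] passes to its derivative r(psi). *)
Lemma Cn_flow N (r psi : R -> R) : der psi (fun t => r (psi t)) -> Cn N r -> Cn N.+1 psi.
Proof.
move=> psid; elim: N => [|N ih] Cr; apply: (Cn_der psid).
  by apply: (Cn_comp Cr); apply/Cn0; exact: der_continuous psid.
by apply: (Cn_comp Cr); exact: ih (Cn_pred Cr).
Qed.

(** [phi] is the primitive of 1 / (b r). Since [r] is positive and periodic, it is an increasing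
    bijection that carries one period to the other, and [b] adjusts the length of the new period to
    [T']. *)
Lemma time_change (T T' : R) (r r' : R -> R) : 0 < T -> 0 < T' -> der r r' ->
  (forall t, 0 < r t) -> periodic T r ->
  exists (b : R) (phi psi : R -> R), [/\ 0 < b, cancel phi psi, cancel psi phi,
    {mono phi : s t / s < t} &
    [/\ phi 0 = 0, forall s, phi (s + T) = phi s + T' & der psi (fun t => b * r (psi t))]].
Proof.
move=> T0 T'0 rd r0 rT.
have r_neq0 t : r t != 0 by rewrite gt_eqF.
have ic := (Cn0 _).1 (Cn_inv r_neq0 ((Cn0 _).2 (der_continuous rd))).
have [F Fd F0] := primitive_exists ic.
have Fc := der_continuous Fd.
have Finc s t : s < t -> F s < F t.
  move=> st; apply: (derive_gt0_lt st (fun u _ => Fd u) (fun u _ => Fc u)) => u _.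
  by rewrite invr_gt0.
have FT s : F (s + T) = F s + F T.
  have d : der (fun t => F (t + T) - F t) (fun=> 0).
    move=> t; have := der_comp_affine 1 T Fd t.
    under eq_fun do rewrite mul1r; rewrite !mul1r rT => h.
    by derive_solve; ring.
  by have := der0_const d s 0; rewrite add0r F0; lra.
have FT0 : 0 < F T by rewrite -F0; exact: Finc.
pose b := F T / T'; have b0 : 0 < b by rewrite divr_gt0.
pose phi t := F t / b.
have phid : der phi (fun t => (b * r t)^-1).
  by move=> t; rewrite /phi; derive_solve; field; rewrite r_neq0 gt_eqF.
have mono : {mono phi : s t / s < t}.
  apply: leW_mono; apply: le_mono => s t st.
  by rewrite /phi ltr_pM2r ?invr_gt0//; exact: Finc.
have phi0 : phi 0 = 0 by rewrite /phi F0 mul0r.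
have phiT s : phi (s + T) = phi s + T'.
  by rewrite /phi FT mulrDl /b; congr (_ + _); field; rewrite !gt_eqF.
have phin n s : phi (s + n%:R * T) = phi s + n%:R * T'.
  elim: n => [|n ih]; first by rewrite !mul0r !addr0.
  by rewrite -[n.+1%:R]natr1 !mulrDl !mul1r addrA phiT ih addrA.
have surj t : exists s, phi s = t.
  pose n := (Num.truncn (`|t| / T')).+1.
  have tn : `|t| < n%:R * T' by rewrite -ltr_pdivrMr// truncnS_gt.
  have p1 : phi (n%:R * T) = n%:R * T' by have := phin n 0; rewrite !add0r phi0 add0r.
  have p2 : phi (- (n%:R * T)) = - (n%:R * T').
    by have := phin n (- (n%:R * T)); rewrite addNr phi0; lra.
  have nT : - (n%:R * T) <= n%:R * T by rewrite ge0_cp ?mulr_ge0// ltW.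
  have phiw : {within `[- (n%:R * T), n%:R * T], continuous phi}.
    by apply: within_continuous => u _; exact: der_continuous phid u.
  have tb : Num.min (phi (- (n%:R * T))) (phi (n%:R * T)) <= t <=
            Num.max (phi (- (n%:R * T))) (phi (n%:R * T)).
    rewrite p1 p2 ge_min le_max; move: tn; rewrite ltr_norml => /andP[h1 h2].
    by rewrite (ltW h1) (ltW h2) orbT.
  by have [s _ <-] := IVT nT phiw tb; exists s.
have [psi psiK] := choice surj.
have phiK : cancel phi psi.
  move=> s; have E := psiK (phi s); have [h|h|//] := ltgtP (psi (phi s)) s.
    by move: h; rewrite -mono E ltxx.
  by move: h; rewrite -mono E ltxx.
exists b, phi, psi; split => //; split => // t.
have h0 : (b * r (psi t))^-1 != 0 by rewrite invr_eq0 mulf_neq0// gt_eqF.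
have n1 : {near psi t, cancel phi psi}.
  by near=> u; exact: phiK.
have n2 : \forall u \near psi t, {for u, continuous phi}.
  by near=> u; exact: der_continuous phid u.
by have := is_derive_inverse n1 n2 (phid (psi t)) h0; rewrite psiK invrK.
Unshelve. all: by end_near.
Qed.

End reparametrization.

(** * Existence of a lift with constant alpha *)

Section existence.
Context {R : realType}.
Implicit Types (K : set (vec3 R)).

(** The determinant keeps its sign by continuity; if it is negative, the curve is traversed
    backwards, which changes the sign of x' only. *)
Lemma oriented_lift K k : (5 <= k)%N -> Ck_pos_curved_boundary K k ->
  exists (T : R) (x x1 x2 x3 : R -> vec3 R), [/\ 0 < T, lifts_boundary K T x,
    [/\ Cn k x, der x x1, der x1 x2 & der x2 x3] &
    forall t, 0 < det3 (x2 t) (x1 t) (x t)].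
Proof.
case: k => [//|[//|[//|k]]] _ [T [x [T0 [lb [Cx dx]]]]].
have /CnS[x1 d1 /CnS[x2 d2 /CnS[x3 d3 C3]]] := Cx.
have dE s : det3 (x2 s) (x1 s) (x s) != 0.
  have := dx s; rewrite /derive1n /= (der_derive1 d1) (der_derive1 d2).
  suff -> : det3 (x2 s) (x1 s) (x s) = - det3 (x s) (x1 s) (x2 s) by rewrite oppr_eq0.
  by rewrite !det3E; ring.
have C2 : Cn 0 x2 by apply/Cn0; exact: der_continuous d3.
have C1 : Cn 0 x1 by apply/Cn0; exact: der_continuous d2.
have C0 : Cn 0 x by apply/Cn0; exact: der_continuous d1.
have Dc := (Cn0 _).1 (Cn_det3 C2 C1 C0).
have [D0|D0] := ltP 0 (det3 (x2 0) (x1 0) (x 0)).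
  exists T, x, x1, x2, x3; split; [exact: T0|exact: lb|by split|].
  exact: (continuous_nonzero_gt0 Dc dE D0).
have NDc : continuous (fun t => - det3 (x2 t) (x1 t) (x t)) by move=> t; exact: cvgN (Dc t).
have NdE s : - det3 (x2 s) (x1 s) (x s) != 0 by rewrite oppr_eq0.
have ND0 : 0 < - det3 (x2 0) (x1 0) (x 0) by rewrite oppr_gt0 lt_neqAle dE.
have neg := continuous_nonzero_gt0 NDc NdE ND0.
have opp_der (f f' : R -> vec3 R) : der f f' -> der (fun t => f (- t)) (fun t => - f' (- t)).
  move=> ff' t; have h : is_derive t 1 (fun s : R => - s) (- 1) by derive_solve.
  exact: is_derive_ext (is_derive_row_comp (ff' (- t)) h) (scaleN1r _).
have e1 := opp_der _ _ d1; have e2 := opp_der _ _ d2; have e3 := opp_der _ _ d3.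
exists T, (fun t => x (- t)), (fun t => - x1 (- t)), (fun t => x2 (- t)), (fun t => - x3 (- t)).
split.
- exact: T0.
- exact: lifts_boundary_opp.
- split; [exact: Cn_opp_arg|exact: e1| |exact: e3].
  by move=> t; derive_solve; rewrite opprK.
- move=> t; have := neg (- t).
  suff -> : det3 (x2 (- t)) (- x1 (- t)) (x (- t)) = - det3 (x2 (- t)) (x1 (- t)) (x (- t)) by [].
  by rewrite !det3E !mxE; ring.
Qed.

Lemma normalized_lift_exists K n : regular_convex_cone K -> Ck_pos_curved_boundary K n.+4.+1 ->
  exists (T : R) (x : R -> vec3 R) (m : R -> R) (y1 y2 y3 : R -> vec3 R) (al al' de : R -> R),
    [/\ normalized_lift K T (fun t => m t *: x t) y1 y2 y3,
        forall t, y3 t = - (2 * al t) *: y1 t - de t *: (m t *: x t),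
        [/\ der al al', periodic T al & Cn n.+1 al],
        [/\ Cn n.+4.+1 x, Cn n.+3 m & forall t, 0 < m t] &
        forall t, x t != 0].
Proof.
move=> HK /(oriented_lift (isT : (5 <= n.+4.+1)%N)).
move=> [T [x [x1 [x2 [x3 [T0 lb [Cx d1 d2 d3] D0]]]]]].
have C1 := Cn_derivative d1 Cx; have C2 := Cn_derivative d2 C1.
have C3 := Cn_derivative d3 C2.
pose D t := det3 (x2 t) (x1 t) (x t).
have CD : Cn n.+3 D by exact: Cn_det3 C2 (Cn_pred C1) (Cn_pred (Cn_pred Cx)).
(* Scaling a lift by [m] multiplies the determinant by m^3, so [m] is D^(-1/3). *)
pose m t := expR (- ln (D t) / 3).
have Clog : Cn n.+3 (fun t => ln (D t)) by exact: Cn_ln.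
have Cm : Cn n.+3 m by apply: Cn_expR; repeat Cn_step.
have m0 t : 0 < m t by exact: expR_gt0.
have m3D t : m t ^+ 3 * D t = 1.
  have DE : D t = expR (ln (D t)) by rewrite lnK// posrE; exact: D0.
  rewrite /m {2}DE -expRM_natl -expRD -[RHS]expR0; congr expR.
  by field.
have /CnS[m1 md1 Cm1] := Cm; have /CnS[m2 md2 Cm2] := Cm1; have /CnS[m3 md3 _] := Cm2.
have xT := lb.1; have x1T := der_row_periodic d1 xT; have x2T := der_row_periodic d2 x1T.
have x3T := der_row_periodic d3 x2T.
have mT : periodic T m by move=> t; rewrite /m /D xT x1T x2T.
have m1T := der_periodic md1 mT; have m2T := der_periodic md2 m1T.
pose y t := m t *: x t; pose y1 t := m1 t *: x t + m t *: x1 t.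
pose y2 t := m2 t *: x t + (2 * m1 t) *: x1 t + m t *: x2 t.
pose y3 t := m3 t *: x t + (3 * m2 t) *: x1 t + (3 * m1 t) *: x2 t + m t *: x3 t.
have yd1 : der y y1 by move=> t; rewrite /y /y1; derive_solve.
have yd2 : der y1 y2.
  by move=> t; rewrite /y1 /y2; derive_solve; apply/rowP => i; rewrite !mxE; ring.
have yd3 : der y2 y3.
  by move=> t; rewrite /y2 /y3; derive_solve; apply/rowP => i; rewrite !mxE; ring.
have yD t : det3 (y2 t) (y1 t) (y t) = 1.
  by rewrite -(m3D t) /D /y2 /y1 /y !det3E !mxE; ring.
(* This is - det (y'', y''', y) / 2 expanded. The third derivative of [m] occurs only along [x] and
   drops out, so [al] is of class C^(k-4) although [m] is only C^(k-2). *)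
pose al t : R := - 2^-1 * (m t * (6 * (m1 t * m1 t) * det3 (x1 t) (x2 t) (x t)
  + 2 * (m1 t * m t) * det3 (x1 t) (x3 t) (x t) + 3 * (m t * m2 t) * det3 (x2 t) (x1 t) (x t)
  + m t * m t * det3 (x2 t) (x3 t) (x t))).
have alE t : al t = - 2^-1 * det3 (y2 t) (y3 t) (y t).
  by rewrite /al /y2 /y3 /y !det3E !mxE; ring.
have Cal : Cn n.+1 al.
  have c0 := Cn_pred (Cn_pred (Cn_pred (Cn_pred Cx))).
  have c1 := Cn_pred (Cn_pred (Cn_pred C1)); have c2 := Cn_pred (Cn_pred C2).
  have c3 := Cn_pred C3; have cm := Cn_pred (Cn_pred Cm); have cm1 := Cn_pred Cm1.
  have D1 := Cn_det3 c1 c2 c0; have D2 := Cn_det3 c1 c3 c0.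
  have D3 := Cn_det3 c2 c1 c0; have D4 := Cn_det3 c2 c3 c0.
  rewrite /al; repeat Cn_step.
have /CnS[al' ald _] := Cal.
have alT : periodic T al by move=> t; rewrite /al !(mT, m1T, m2T, xT, x1T, x2T, x3T).
pose de t := - det3 (y2 t) (y1 t) (y3 t).
(* Differentiating the normalization shows that y''' has no component along y''. *)
have z t : det3 (y3 t) (y1 t) (y t) = 0.
  have h : is_derive t 1 (fun s => det3 (y2 s) (y1 s) (y s)) (det3 (y3 t) (y1 t) (y t)).
    by derive_solve; rewrite !det3E; ring.
  apply: is_derive_uniq h _.
  have -> : (fun s => det3 (y2 s) (y1 s) (y s)) = (fun=> 1) by apply/funext.
  exact: is_derive_const.
exists T, x, m, y1, y2, y3, al, al', de; split.
- by split; [exact: HK|exact: T0|exact: lifts_boundary_scale|exact: yd1|exact: yd2|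
    exact: yd3|exact: yD].
- move=> t; rewrite [LHS](det3_basis (y3 t) (yD t)) z scale0r add0r alE /de -/(y t).
  by congr (_ *: _ + _); [field|rewrite scaleNr opprK].
- by split; [exact: ald|exact: alT|exact: Cal].
- by split; [exact: Cx|exact: Cm|exact: m0].
- by move=> t; apply/eqP => x0; have := D0 t; rewrite x0 det3_0r ltxx.
Qed.

Theorem const_alpha_lift_exists K k : (5 <= k)%N -> regular_convex_cone K ->
  Ck_pos_curved_boundary K k ->
  exists (a : R) (y : R -> vec3 R) (beta : R -> R), const_alpha_lift K k y a beta.
Proof.
case: k => [//|[//|[//|[//|[//|n]]]]] _ HK HC.
have [T [x [m [y1 [y2 [y3 [al [al' [de [lift ode [ald alT Cal] [Cx Cm m0] x0]]]]]]]]]] :=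
  normalized_lift_exists HK HC.
have T0 := lift_period lift; have lb := lift_bdry lift.
have d1 := lift_der1 lift; have d2 := lift_der2 lift; have d3 := lift_der3 lift.
have dt1 := lift_det lift.
pose yt t := m t *: x t; rewrite -/yt in lift lb d1 dt1.
have [rh [rh1 [rh2 [c0 [rhd1 rhd2 rh0 rhT [rhE rhC]]]]]] := invariant_density lift ode ald alT.
have pi2 : 0 < 2 * pi :> R by rewrite mulr_gt0 ?pi_gt0.
have [b [phi [psi [b0 phiK psiK mono [phi0 phiT psid]]]]] := time_change T0 pi2 rhd1 rh0 rhT.
pose r t := b * rh t; pose r1 t := b * rh1 t; pose r2 t := b * rh2 t.
pose c := b ^+ 2 * c0.
have rd1 : der r r1 by move=> t; rewrite /r /r1; derive_solve; ring.
have rd2 : der r1 r2 by move=> t; rewrite /r1 /r2; derive_solve; ring.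
have r0 t : 0 < r t by rewrite mulr_gt0.
have rn0 t : r t != 0 by rewrite gt_eqF.
have rE t : 2 * r t * r2 t - r1 t ^+ 2 + 2 * al t * r t ^+ 2 = c.
  by rewrite /c -(rhE t) /r /r1 /r2; ring.
have Cr : Cn n.+3 r by have Crh := rhC _ Cal; rewrite /r; repeat Cn_step.
(* [r] is of class C^(k-2), and k >= 5 gives the third derivative. *)
have [r3 rd3] : exists r3, der r2 r3.
  have C2 : Cn n.+1 r2 := Cn_derivative rd2 (Cn_derivative rd1 Cr).
  by have /CnS[r3 rd3 _] := C2; exists r3.
have rT : periodic T r by move=> t; rewrite /r rhT.
(* The new parameter multiplies the determinant by r^3, so a lift divided by [r] stays normalized.
   [Y1], [Y2], [Y3] are its derivatives in the new parameter, written in the old one. *)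
pose Y0 t := (r t)^-1 *: yt t.
pose Y1 t := y1 t - (r1 t / r t) *: yt t.
pose Y2 t := r t *: y2 t - r1 t *: y1 t - (r2 t - r1 t ^+ 2 / r t) *: yt t.
(* In the third derivative the coefficient of [y1] is [- c] by [rE] and that of [yt] is [- E].
   Rewriting [y1] through [Y1] and [yt] through [Y0] gives [B], the new beta. *)
pose E t := r t ^+ 2 * de t + r t * r3 t - 2 * r1 t * r2 t + r1 t ^+ 3 / r t.
pose B t := r t * E t + c * r1 t.
pose Y3 t := - c *: Y1 t - B t *: Y0 t.
have compd (Y Y' : R -> vec3 R) : der Y (fun t => (r t)^-1 *: Y' t) ->
    der (fun t => Y (psi t)) (fun t => Y' (psi t)).
  move=> YY' t; apply: is_derive_ext (is_derive_row_comp (YY' (psi t)) (psid t)) _.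
  by rewrite scalerA -/(r (psi t)) mulfV ?scale1r.
have yd0 : der yt y1 := d1.
have D1 : der (fun t => Y0 (psi t)) (fun t => Y1 (psi t)).
  apply: compd => t; rewrite /Y0 /Y1; derive_solve; [exact: rn0|].
  by apply/rowP => i; rewrite !mxE; field.
have D2 : der (fun t => Y1 (psi t)) (fun t => Y2 (psi t)).
  apply: compd => t; rewrite /Y1 /Y2; derive_solve; [exact: rn0|].
  by apply/rowP => i; rewrite !mxE; field.
have D3 : der (fun t => Y2 (psi t)) (fun t => Y3 (psi t)).
  apply: compd => t; rewrite /Y2; derive_solve; [exact: rn0|].
  rewrite /Y3 /Y1 /Y0 /B /E ode -/(yt t) -(rE t).
  by apply/rowP => i; rewrite !mxE; field.
pose y t := Y0 (psi t).
have yE : y = (fun t => ((r (psi t))^-1 * m (psi t)) *: x (psi t)).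
  by apply/funext => t; rewrite /y /Y0 /yt scalerA.
have Cpsi : Cn n.+4 psi by exact: Cn_flow psid Cr.
have lby : lifts_boundary K (2 * pi) y.
  apply: (lifts_boundary_comp phiK psiK mono phi0 phiT).
  apply: lifts_boundary_scale lb; first by move=> t; rewrite invr_gt0.
  by move=> t; rewrite rT.
have y0 t : y t != 0.
  by rewrite yE scaler_eq0 negb_or x0 andbT mulf_neq0 ?invr_eq0 ?rn0// gt_eqF.
have ode' t : Y3 (psi t) + (2 * (c / 2)) *: Y1 (psi t) + B (psi t) *: y t = 0.
  by rewrite /Y3 /y; apply/rowP => i; rewrite !mxE; field.
have p0 : periodic (2 * pi) y := lby.1.
have p1 := der_row_periodic D1 p0; have p2 := der_row_periodic D2 p1.
have p3 := der_row_periodic D3 p2.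
have k2 : (n.+4.+1 - 2 = n.+3)%N by rewrite !subSS subn0.
have k1 : (n.+4.+1 - 1 = n.+4)%N by rewrite subSS subn0.
have e1 : derive1n 1 y = (fun t => Y1 (psi t)) by exact: der_derive1.
have e2 : derive1n 2 y = (fun t => Y2 (psi t)) by rewrite derive1nS e1; exact: der_derive1.
have e3 : derive1n 3 y = (fun t => Y3 (psi t)) by rewrite derive1nS e2; exact: der_derive1.
exists (c / 2), y, (fun t => B (psi t)); split; first exact: lby.
split.
  rewrite k2 yE; have C1 := Cn_pred Cpsi.
  apply: (Cn_scale _ (Cn_row_comp _ C1)); last exact: (Cn_pred (Cn_pred Cx)).
  apply: (Cn_mul _ (Cn_comp Cm C1)); apply: Cn_inv; first by move=> t; exact: rn0.
  exact: Cn_comp Cr C1.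
split.
  (* Without the scaling factor, which is only C^(k-2), the original lift keeps the class C^(k-1) of
     [psi]. *)
  exists (fun t => x (psi t)); rewrite k1; split; first exact: Cn_row_comp (Cn_pred Cx) Cpsi.
  move=> t; split; first exact: x0.
  by exists ((r (psi t))^-1 * m (psi t)); rewrite mulr_gt0 ?invr_gt0// yE.
rewrite e1 e2 e3; split.
  move=> t; rewrite -(dt1 (psi t)) /y /Y0 /Y1 /Y2 !det3E !mxE; field.
  exact: rn0.
split; last exact: ode'.
(* The equation determines beta, because [y] and its derivatives are periodic and [y] does not
   vanish. *)
move=> t; have h1 := ode' (t + 2 * pi); have h2 := ode' t.
rewrite p0 p3 p1 in h1.
have {h1 h2} : (B (psi (t + 2 * pi)) - B (psi t)) *: y t = 0.
  by rewrite scalerBl; apply/eqP; rewrite subr_eq0; apply/eqP; apply: (addrI _ (etrans h1 (esym h2))).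
by move=> /eqP; rewrite scaler_eq0 (negbTE (y0 t)) orbF subr_eq0 => /eqP.
Qed.

End existence.

(** * The change of parameter between two solutions *)

Section comparison.
Context {R : realType} {K : set (vec3 R)} {T : R}.
Context {x x1 x2 x3 z z1 z2 z3 : R -> vec3 R} {a1 a2 : R} {b1 b2 : R -> R}.

Hypothesis liftx : normalized_lift K T x x1 x2 x3.
Hypothesis liftz : normalized_lift K T z z1 z2 z3.
Hypothesis odex : forall t, x3 t = - (2 * a1) *: x1 t - b1 t *: x t.
Hypothesis odez : forall t, z3 t = - (2 * a2) *: z1 t - b2 t *: z t.

Let T0 : 0 < T := lift_period liftx.
Let xd1 : der x x1 := lift_der1 liftx.
Let xd2 : der x1 x2 := lift_der2 liftx.
Let xd3 : der x2 x3 := lift_der3 liftx.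
Let xD : forall t, det3 (x2 t) (x1 t) (x t) = 1 := lift_det liftx.
Let zd1 : der z z1 := lift_der1 liftz.
Let zd2 : der z1 z2 := lift_der2 liftz.
Let zd3 : der z2 z3 := lift_der3 liftz.
Let zD : forall t, det3 (z2 t) (z1 t) (z t) = 1 := lift_det liftz.

Lemma lift_param : exists mu : R -> R, forall t, 0 < mu t /\ exists s, z t = mu t *: x s.
Proof.
have /choice[mu muP] : forall t, exists l : R, 0 < l /\ exists s, z t = l *: x s.
  move=> t; have [_ [bdx _]] := lift_bdry liftx; have [_ [bdz _]] := lift_bdry liftz.
  have /bdx[l [s [l0 E]]] : bdry K (z t) /\ z t <> 0.
    by apply/bdz; exists 1, t; rewrite ltr01 scale1r.
  by exists l; split => //; exists s.
by exists mu.
Qed.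

Lemma lift_param_uniq s s' l l' : 0 < l -> 0 < l' -> l *: x s = l' *: x s' -> l = l'.
Proof.
move=> l0 l'0 E; have [xT _] := lift_bdry liftx.
have [n /andP[n0 nT]] := period_reduce (s' - s) T0.
have [E0|ne] := eqVneq (s' - s + n%:~R * T) 0.
  have xs : x s' = x s.
    by rewrite -(periodic_int n s' xT); congr x; lra.
  move: E; rewrite xs => /eqP; rewrite -subr_eq0 -scalerBl scaler_eq0 subr_eq0.
  move=> /orP[/eqP//|/eqP xs0]; have := xD s; rewrite xs0 det3_0r => /esym/eqP.
  by rewrite oner_eq0.
exfalso; apply: (@lifts_boundary_inj R K T x T0 (lift_bdry liftx) s (s' + n%:~R * T) (l / l')).
- have : 0 < s' - s + n%:~R * T by rewrite lt_def ne.
  by lra.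
- exact: divr_gt0.
- rewrite periodic_int// mulrC -scalerA E scalerA mulVf ?scale1r//.
  by rewrite gt_eqF.
Qed.

(* The pencil of planes through the ray of [x s0] parametrizes the remaining rays of
   the boundary; comparing the two lifts through it gives the change of parameter. *)
Lemma local_change mu t0 : (forall t, 0 < mu t /\ exists s, z t = mu t *: x s) ->
  exists (s0 : R) (sg m1 m2 : R -> R), forall t, t0 < t < t0 + T ->
    [/\ s0 < sg t < s0 + T, is_derive t 1 sg (mu t)^-1, is_derive t 1 mu (m1 t),
        is_derive t 1 m1 (m2 t) &
        2 * mu t * m2 t - m1 t ^+ 2 - 2 * a1 + 2 * a2 * mu t ^+ 2 = 0].
Proof.
move=> muP; have mu0 t : 0 < mu t by have [] := muP t.
have [_ [s0 zt0]] := muP t0.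
have [xT _] := lift_bdry liftx.
(* Modulo the period the parameter can be taken in the open window after [s0]: the value [s0] itself
   would repeat the ray of [z t0] too early. *)
have /choice[sg sgP] : forall t, exists s, t0 < t < t0 + T ->
    s0 < s < s0 + T /\ z t = mu t *: x s.
  move=> t; have [_ [s zt]] := muP t.
  have [n /andP[n0 nT]] := period_reduce (s - s0) T0.
  exists (s + n%:~R * T) => tt; split; last by rewrite periodic_int.
  have [E0|ne] := eqVneq (s - s0 + n%:~R * T) 0; last first.
    have : 0 < s - s0 + n%:~R * T by rewrite lt_def ne.
    by lra.
  exfalso; apply: (@lifts_boundary_inj R K T z T0 (lift_bdry liftz) t0 t (mu t / mu t0)).
  - by lra.
  - exact: divr_gt0.
  - have xs : x s = x s0 by rewrite -(periodic_int n s xT); congr x; lra.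
    by rewrite zt0 scalerA divfK ?zt ?xs// gt_eqF.
pose p := x s0; pose B := x1 s0; pose A := x2 s0.
have ABp : det3 A B p = 1 := xD s0.
pose n s := det3 (x s) B p; pose n1 s := det3 (x1 s) B p; pose n2 s := det3 (x2 s) B p.
pose e s := det3 (x s) A p; pose e1 s := det3 (x1 s) A p.
pose N t := det3 (z t) B p; pose N1 t := det3 (z1 t) B p; pose N2 t := det3 (z2 t) B p.
pose E t := det3 (z t) A p; pose E1 t := det3 (z1 t) A p.
pose h s := det3 p (x1 s) (x s); pose h1 s := det3 p (x2 s) (x s).
pose H t := det3 p (z1 t) (z t); pose H1 t := det3 p (z2 t) (z t).
have nd1 : der n n1 by move=> s; rewrite /n /n1; derive_solve; rewrite !det3E !mxE; ring.
have nd2 : der n1 n2 by move=> s; rewrite /n1 /n2; derive_solve; rewrite !det3E !mxE; ring.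
have ed1 : der e e1 by move=> s; rewrite /e /e1; derive_solve; rewrite !det3E !mxE; ring.
have hd1 : der h h1 by move=> s; rewrite /h /h1; derive_solve; rewrite !det3E !mxE; ring.
have Nd1 : der N N1 by move=> s; rewrite /N /N1; derive_solve; rewrite !det3E !mxE; ring.
have Nd2 : der N1 N2 by move=> s; rewrite /N1 /N2; derive_solve; rewrite !det3E !mxE; ring.
have Ed1 : der E E1 by move=> s; rewrite /E /E1; derive_solve; rewrite !det3E !mxE; ring.
have Hd1 : der H H1 by move=> s; rewrite /H /H1; derive_solve; rewrite !det3E !mxE; ring.
have hE s : e1 s * n s - e s * n1 s = h s.
  rewrite -[RHS]mul1r -ABp /e /e1 /n /n1 /h !det3E; ring.
have HE t : E1 t * N t - E t * N1 t = H t.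
  rewrite -[RHS]mul1r -ABp /E /E1 /N /N1 /H !det3E; ring.
have n0 s : s0 < s < s0 + T -> 0 < n s.
  by move=> ss; rewrite -[n s]/(tangent_form x x1 s0 s) (tangent_form_gt0 liftx).
have h0 s : s0 < s < s0 + T -> 0 < h s.
  by move=> ss; rewrite -[h s]/(tangent_form x x1 s s0) (tangent_form_dual_gt0 liftx).
(* The ratio of two forms vanishing on [p] is a coordinate on the pencil. It depends only on the ray
   and increases strictly along [x], so [sg] is its inverse applied to [Om], which gives the
   differentiability of [sg]. *)
pose om s := e s / n s; pose Om t := E t / N t.
have omd s : s0 < s < s0 + T -> is_derive s 1 om (h s / n s ^+ 2).
  move=> ss; have ns := n0 s ss; rewrite -hE /om; derive_solve; [by rewrite gt_eqF|].
  by field; rewrite gt_eqF.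
have omlt s s' : s0 < s -> s < s' -> s' < s0 + T -> om s < om s'.
  move=> ss0 ss' s'T; apply: (@derive_gt0_lt _ _ (fun s => h s / n s ^+ 2)) => // u uu.
  - by apply: omd; lra.
  - by apply: is_derive_continuous (omd u _); lra.
  - by rewrite divr_gt0 ?exprn_gt0 ?h0 ?n0//; lra.
have ominj s s' : s0 < s < s0 + T -> s0 < s' < s0 + T -> om s = om s' -> s = s'.
  move=> /andP[h1' h2'] /andP[h3' h4'] oE; have [ss|ss|//] := ltgtP s s'.
    by have := omlt _ _ h1' ss h4'; rewrite oE ltxx.
  by have := omlt _ _ h3' ss h2'; rewrite oE ltxx.
have /choice[g gP] : forall w, exists s, (exists2 s', s0 < s' < s0 + T & om s' = w) ->
    s0 < s < s0 + T /\ om s = w.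
  move=> w; have [[s' ss ow]|no] := pselect (exists2 s', s0 < s' < s0 + T & om s' = w).
    by exists s'.
  by exists 0 => /no.
have gK s : s0 < s < s0 + T -> g (om s) = s.
  move=> ss; have [gs go] : s0 < g (om s) < s0 + T /\ om (g (om s)) = om s.
    by apply: gP; exists s.
  exact: ominj.
have NE t : t0 < t < t0 + T -> N t = mu t * n (sg t).
  by move=> tt; have [_ zt] := sgP t tt; rewrite /N /n zt !det3E !mxE; ring.
have EE t : t0 < t < t0 + T -> E t = mu t * e (sg t).
  by move=> tt; have [_ zt] := sgP t tt; rewrite /E /e zt !det3E !mxE; ring.
have N0 t : t0 < t < t0 + T -> 0 < N t.
  by move=> tt; have [ss _] := sgP t tt; rewrite NE// mulr_gt0// n0.
have omE t : t0 < t < t0 + T -> om (sg t) = Om t.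
  move=> tt; have [ss _] := sgP t tt; rewrite /om /Om NE// EE//; field.
  by rewrite !gt_eqF ?n0.
have near_in (P : R -> Prop) t a b : a < t < b -> (forall s, a < s < b -> P s) ->
    \forall s \near t, P s.
  move=> /andP[at_ tb] HP; apply/nbhs_ballP.
  exists (Num.min (t - a) (b - t)); first by rewrite /= lt_min !subr_gt0 at_.
  move=> s; rewrite /ball/= lt_min !ltr_norml => /andP[/andP[h1' h2'] /andP[h3' h4']].
  by apply: HP; lra.
pose sg1 t := (H t / N t ^+ 2) / (h (sg t) / n (sg t) ^+ 2).
have sgd t : t0 < t < t0 + T -> is_derive t 1 sg (sg1 t).
  move=> tt; have [ss _] := sgP t tt; have Nt := N0 t tt.
  have gd : is_derive (om (sg t)) 1 g (h (sg t) / n (sg t) ^+ 2)^-1.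
    apply: is_derive_inverse (omd _ ss) _.
    - exact: near_in ss gK.
    - by apply: near_in ss _ => s /omd; exact: is_derive_continuous.
    - by rewrite gt_eqF// divr_gt0 ?exprn_gt0 ?h0 ?n0.
  rewrite omE// in gd.
  have Omd : is_derive t 1 Om (H t / N t ^+ 2).
    rewrite -HE /Om; derive_solve; [by rewrite gt_eqF|].
    by field; rewrite gt_eqF.
  have gOm := is_derive_comp gd Omd.
  apply: is_derive_ext (near_eq_is_derive _ gOm) _; last by rewrite /sg1 mulrC.
  by apply: near_in tt _ => u uu; rewrite -omE// gK//; have [] := sgP u uu.
have comp (f f' : R -> R) t : der f f' -> t0 < t < t0 + T ->
    is_derive t 1 (fun t => f (sg t)) (f' (sg t) * sg1 t).
  by move=> ff' tt; exact: is_derive_comp (ff' _) (sgd t tt).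
have rcomp (f f' : R -> vec3 R) t : der f f' -> t0 < t < t0 + T ->
    is_derive t 1 (fun t => f (sg t)) (sg1 t *: f' (sg t)).
  by move=> ff' tt; exact: is_derive_row_comp (ff' _) (sgd t tt).
have /choice[sg2 sgd2] : forall t, exists d, t0 < t < t0 + T -> is_derive t 1 sg1 d.
  move=> t; have [tt|nt] := boolP (t0 < t < t0 + T); last by exists 0.
  have [ss _] := sgP t tt; have c1 := comp _ _ t nd1 tt; have c2 := comp _ _ t hd1 tt.
  have g1 : N t ^+ 2 != 0 by rewrite gt_eqF// exprn_gt0// N0.
  have g2 : n (sg t) ^+ 2 != 0 by rewrite gt_eqF// exprn_gt0// n0.
  have g3 : h (sg t) / n (sg t) ^+ 2 != 0 by rewrite gt_eqF// divr_gt0 ?exprn_gt0 ?h0 ?n0.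
  by eexists=> _; rewrite /sg1; repeat derive_step.
pose m1 t := (N1 t * n (sg t) - N t * (n1 (sg t) * sg1 t)) / n (sg t) ^+ 2.
have mud t : t0 < t < t0 + T -> is_derive t 1 mu (m1 t).
  move=> tt; have [ss _] := sgP t tt; have ns := n0 _ ss.
  have c1 := comp _ _ t nd1 tt.
  have d : is_derive t 1 (fun u => N u / n (sg u)) (m1 t).
    rewrite /m1; derive_solve; [by rewrite gt_eqF|].
    by field; rewrite gt_eqF.
  apply: near_eq_is_derive d; apply: near_in tt _ => u uu.
  by have [us _] := sgP u uu; rewrite NE// mulfK// gt_eqF// n0.
have /choice[m2 mud2] : forall t, exists d, t0 < t < t0 + T -> is_derive t 1 m1 d.
  move=> t; have [tt|nt] := boolP (t0 < t < t0 + T); last by exists 0.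
  have [ss _] := sgP t tt; have c1 := comp _ _ t nd1 tt; have c2 := comp _ _ t nd2 tt.
  have g2 : n (sg t) ^+ 2 != 0 by rewrite gt_eqF// exprn_gt0// n0.
  have sd := sgd2 t tt.
  by eexists=> _; rewrite /m1; repeat derive_step.
have zE t : t0 < t < t0 + T -> z t = mu t *: x (sg t) by move=> /sgP[].
have z1E t : t0 < t < t0 + T -> z1 t = m1 t *: x (sg t) + (mu t * sg1 t) *: x1 (sg t).
  move=> tt; have c1 := rcomp _ _ t xd1 tt; have c2 := mud t tt.
  have d : is_derive t 1 (fun u => mu u *: x (sg u))
      (m1 t *: x (sg t) + (mu t * sg1 t) *: x1 (sg t)).
    by derive_solve; rewrite scalerA.
  exact: derive_eq_on tt zE (zd1 t) d.
(* Comparing the two normalized determinants gives (mu sg')^3 = 1, whose only real solution is mu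
   sg' = 1. *)
have musg t : t0 < t < t0 + T -> mu t * sg1 t = 1.
  move=> tt; have c1 := rcomp _ _ t xd1 tt; have c2 := rcomp _ _ t xd2 tt.
  have c3 := mud t tt; have c4 := mud2 t tt; have c5 := sgd2 t tt.
  have d : is_derive t 1 (fun u => m1 u *: x (sg u) + (mu u * sg1 u) *: x1 (sg u))
     (m2 t *: x (sg t) + (2 * m1 t * sg1 t + mu t * sg2 t) *: x1 (sg t)
      + (mu t * sg1 t ^+ 2) *: x2 (sg t)).
    by derive_solve; apply/rowP => i; rewrite !mxE; ring.
  have z2E := derive_eq_on tt z1E (zd2 t) d.
  have w3 : (mu t * sg1 t) ^+ 3 = 1.
    rewrite -(zD t) z2E (z1E t tt) (zE t tt).
    by rewrite -[LHS]mulr1 -(xD (sg t)) !det3E !mxE; ring.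
  have : (mu t * sg1 t - 1) * ((mu t * sg1 t) ^+ 2 + mu t * sg1 t + 1) = 0.
    transitivity ((mu t * sg1 t) ^+ 3 - 1); first by ring.
    by rewrite w3 subrr.
  move/eqP; rewrite mulf_eq0 => /orP[|/eqP bad]; first by rewrite subr_eq0 => /eqP.
  have : 0 <= (mu t * sg1 t + 2^-1) ^+ 2 by exact: sqr_ge0.
  by move: bad; rewrite !expr2; lra.
have sg1E t : t0 < t < t0 + T -> sg1 t = (mu t)^-1.
  move=> tt; have mn : mu t != 0 by rewrite gt_eqF.
  by apply: (mulfI mn); rewrite musg// mulfV.
have z1E' t : t0 < t < t0 + T -> z1 t = m1 t *: x (sg t) + x1 (sg t).
  by move=> tt; rewrite z1E// musg// scale1r.
have z2E t : t0 < t < t0 + T ->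
    z2 t = m2 t *: x (sg t) + (m1 t / mu t) *: x1 (sg t) + (mu t)^-1 *: x2 (sg t).
  move=> tt; have c1 := rcomp _ _ t xd1 tt; have c2 := rcomp _ _ t xd2 tt.
  have c4 := mud2 t tt.
  have d : is_derive t 1 (fun u => m1 u *: x (sg u) + x1 (sg u))
     (m2 t *: x (sg t) + (m1 t / mu t) *: x1 (sg t) + (mu t)^-1 *: x2 (sg t)).
    by derive_solve; rewrite sg1E// scalerA.
  exact: derive_eq_on tt z1E' (zd2 t) d.
exists s0, sg, m1, m2 => t tt; have [ss _] := sgP t tt; split => //.
- by rewrite -sg1E//; exact: sgd.
- exact: mud.
- exact: mud2.
have mn u : mu u != 0 by rewrite gt_eqF.
(* [m2] is not known to be differentiable. This determinant does not involve it, and differentiating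
   it in two ways with both equations yields the relation. *)
have GE u : t0 < u < t0 + T -> det3 (z2 u) (x2 (sg u)) (x (sg u)) = - (m1 u / mu u).
  move=> uu; rewrite z2E// -[RHS]mulr1 -(xD (sg u)) !det3E !mxE; ring.
have c1 := rcomp _ _ t xd1 tt; have c3 := rcomp _ _ t xd3 tt.
have c2 := mud t tt; have c4 := mud2 t tt.
have dR : is_derive t 1 (fun u => - (m1 u / mu u)) (- (m2 t / mu t - m1 t ^+ 2 / mu t ^+ 2)).
  by derive_solve; [exact: mn|field].
have dL : is_derive t 1 (fun u => det3 (z2 u) (x2 (sg u)) (x (sg u)))
   (2 * a2 + (mu t)^-1 * (- (2 * a1) / mu t + m2 t)).
  derive_solve; rewrite sg1E// odez odex (z1E' t tt) (z2E t tt) (zE t tt).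
  rewrite -[RHS]mulr1 -(xD (sg t)) !det3E !mxE; field; exact: mn.
have key := derive_eq_on tt GE dL dR.
have -> : 2 * mu t * m2 t - m1 t ^+ 2 - 2 * a1 + 2 * a2 * mu t ^+ 2 =
  mu t ^+ 2 * ((2 * a2 + (mu t)^-1 * (- (2 * a1) / mu t + m2 t)) -
     - (m2 t / mu t - m1 t ^+ 2 / mu t ^+ 2)) by field.
by rewrite key subrr mulr0.
Qed.

(** Unlike the matching parameter, the ratio [mu] is defined on the whole line, so the local results
    on windows centered at each point glue without further choice. *)
Lemma global_change : exists mu mu1 mu2 : R -> R,
  [/\ forall t, 0 < mu t /\ (exists s, z t = mu t *: x s), periodic T mu,
      der mu mu1, der mu1 mu2 &
      forall t, 2 * mu t * mu2 t - mu1 t ^+ 2 - 2 * a1 + 2 * a2 * mu t ^+ 2 = 0].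
Proof.
have [mu muP] := lift_param.
have in_t (t : R) : t - T / 2 < t < t - T / 2 + T.
  by have := T0; move=> ?; apply/andP; split; lra.
have loc t : exists m1 m2 : R -> R, forall u, t - T / 2 < u < t - T / 2 + T ->
    [/\ is_derive u 1 mu (m1 u), is_derive u 1 m1 (m2 u) &
      2 * mu u * m2 u - m1 u ^+ 2 - 2 * a1 + 2 * a2 * mu u ^+ 2 = 0].
  have [s0 [sg [m1 [m2 H]]]] := local_change (t - T / 2) muP.
  by exists m1, m2 => u /H[].
pose mu1 : R -> R := mu^`()%classic; pose mu2 : R -> R := mu1^`()%classic.
have d1 : der mu mu1.
  move=> t; have [m1 [m2 H]] := loc t; have [d _ _] := H t (in_t t).
  by split; [case: d|rewrite /mu1 derive1E].
have eq1 (t : R) : is_derive t 1 mu1 (mu2 t) /\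
    2 * mu t * mu2 t - mu1 t ^+ 2 - 2 * a1 + 2 * a2 * mu t ^+ 2 = 0.
  have [m1 [m2 H]] := loc t; have [d dd rel] := H t (in_t t).
  have mE u : t - T / 2 < u < t - T / 2 + T -> m1 u = mu1 u.
    by move=> /H[du _ _]; exact: is_derive_uniq du (d1 u).
  have d2 : is_derive t 1 mu1 (m2 t).
    apply: near_eq_is_derive dd; apply/nbhs_ballP; exists (T / 2) => /=.
      by rewrite divr_gt0.
    by move=> u; rewrite /ball/= ltr_norml => /andP[? ?]; apply: mE; lra.
  have m2E : mu2 t = m2 t by rewrite /mu2 derive1E; case: d2.
  by split; rewrite m2E// -mE// in_t.
exists mu, mu1, mu2; split; [exact: muP| |exact: d1| |].
- move=> t; have [mt [s zs]] := muP t; have [mt' [s' zs']] := muP (t + T).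
  apply: (lift_param_uniq (s := s') (s' := s)) => //.
  by rewrite -zs -zs'; have [zT _] := lift_bdry liftz.
- by move=> t; have [] := eq1 t.
- by move=> t; have [] := eq1 t.
Qed.

(** The change of parameter has slope 1 / m and sends an open window of length [T] into another one,
    so 1 / m cannot exceed 1. *)
Lemma const_ratio_ge1 m : 0 < m -> (forall t, exists s, z t = m *: x s) -> 1 <= m.
Proof.
move=> m0 mP; rewrite leNgt; apply/negP => m1.
have [s0 [sg [k1 [k2 H]]]] := @local_change (fun=> m) 0 (fun t => conj m0 (mP t)).
have tp : 0 < T by exact: T0.
(* With this margin the image of the shortened window has length T (1 + m) / (2 m), which exceeds
   [T] when m < 1. *)
pose e := T * (1 - m) / 4.
have e0 : 0 < e by rewrite /e divr_gt0// mulr_gt0// subr_gt0.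
have eT : e < T / 4 by rewrite /e ltr_pM2r ?invr_gt0// gtr_pMr//; lra.
have sgd t : 0 < t < T -> is_derive t 1 sg m^-1 by rewrite -{1}[T]add0r => /H[].
have lt_e : e < T - e by lra.
have sgd1 t : e < t < T - e -> is_derive t 1 sg m^-1 by move=> tt; apply: sgd; lra.
have sgc t : e <= t <= T - e -> {for t, continuous sg}.
  by move=> tt; apply: is_derive_continuous (sgd t _); lra.
have [c _ E] := mean_value lt_e sgd1 sgc.
have ie : 0 < e < 0 + T by lra.
have ie' : 0 < T - e < 0 + T by lra.
have [h1 _ _ _ _] := H e ie; have [h2 _ _ _ _] := H (T - e) ie'.
have : m^-1 * (T - e - e) < T by lra.
rewrite ltr_pdivrMl// /e; nra.
Qed.

End comparison.

(** * Uniqueness of the constant *)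

Section uniqueness.
Context {R : realType}.
Implicit Types (K : set (vec3 R)) (a : R).

(** Hill's equation has the solution sin (w t) with w^2 = a / 2; its zeros 0 and pi / w would be
    less than 2 pi apart if a > 1/2. *)
Lemma const_alpha_le_half K y y1 y2 y3 a (b : R -> R) :
  normalized_lift K (2 * pi) y y1 y2 y3 ->
  (forall t, y3 t = - (2 * a) *: y1 t - b t *: y t) -> a <= 2^-1.
Proof.
move=> lift ode; rewrite leNgt; apply/negP => a2.
pose w := Num.sqrt (a / 2).
have w2 : w * w = a / 2 by rewrite -expr2 sqr_sqrtr//; lra.
have w0 : 0 < w by rewrite sqrtr_gt0; lra.
have wh : 2^-1 < w.
  rewrite ltNge; apply/negP => wle.
  have : w * w <= 2^-1 * 2^-1 by apply: ler_pM => //; exact: ltW.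
  by rewrite w2; lra.
have hv : hill (fun _ => a / 2) (fun t => sin (w * t + 0)) (fun t => w * cos (w * t + 0)).
  have hs : der (@sin R) cos by move=> t; exact: is_derive_sin.
  have hc : der (@cos R) (fun t => - sin t) by move=> t; exact: is_derive_cos.
  split; first exact: der_comp_affine.
  have h := der_comp_affine w 0 hc.
  by move=> t; derive_solve; rewrite -w2; ring.
have pi0 := pi_gt0 R.
have pw : pi / w < 2 * pi by rewrite ltr_pdivrMr// -mulrA mulrC -mulrA ltr_pMr//; lra.
have pw0 : 0 < pi / w by rewrite divr_gt0.
pose e := (2 * pi - pi / w) / 2.
have s1 : - e < 0 by rewrite /e; lra.
have s2 : pi / w < - e + 2 * pi by rewrite /e; lra.
have v1 : sin (w * 0 + 0) = 0 :> R by rewrite mulr0 addr0 sin0.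
have v2 : sin (w * (pi / w) + 0) = 0 by rewrite addr0 mulrC divfK ?gt_eqF// sinpi.
have := hill_zeros_apart lift ode hv s1 pw0 s2 v1 v2.
by rewrite mulr0 addr0 cos0 mulr1 => w00; rewrite w00 ltxx in w0.
Qed.

Lemma periodic_attains_max (T : R) (f : R -> R) : 0 < T -> continuous f -> periodic T f ->
  exists c, forall t, f t <= f c.
Proof.
move=> T0 fc fT.
have fw : {within `[0, T], continuous f} by apply: within_continuous => t _; exact: fc.
have [c _ cP] := EVT_max (ltW T0) fw; exists c => t.
have [n /andP[n0 nT]] := period_reduce t T0.
by rewrite -(periodic_int n t fT); apply: cP; rewrite in_itv/= n0 ltW.
Qed.

Lemma periodic_attains_min (T : R) (f : R -> R) : 0 < T -> continuous f -> periodic T f ->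
  exists c, forall t, f c <= f t.
Proof.
move=> T0 fc fT.
have Nc : continuous (fun t => - f t) by move=> t; exact: cvgN (fc t).
have [|c cP] := @periodic_attains_max T (fun t => - f t) T0 Nc; first by move=> t; rewrite fT.
by exists c => t; rewrite -lerN2.
Qed.

Lemma cos_lt1 (t : R) : 0 < t < 2 * pi -> cos t < 1.
Proof.
move=> tt; have s0 : 0 < sin (t / 2) by apply: sin_gt0_pi; lra.
have -> : t = t / 2 + t / 2 by field.
rewrite cosD -!expr2 cos2sin2; have : 0 < sin (t / 2) ^+ 2 by exact: exprn_gt0.
by lra.
Qed.

Lemma periodic_ratio_const (mu mu1 mu2 : R -> R) (a1 a2 : R) :
  (forall t, 0 < mu t) -> periodic (2 * pi) mu -> der mu mu1 -> der mu1 mu2 ->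
  (forall t, 2 * mu t * mu2 t - mu1 t ^+ 2 - 2 * a1 + 2 * a2 * mu t ^+ 2 = 0) ->
  a2 < 2^-1 -> a1 = a2 \/ exists m, forall t, mu t = m.
Proof.
move=> mu0 muT d1 d2 rel a2h.
have pi0 := pi_gt0 R; have pi2 : 0 < 2 * pi :> R by lra.
have muc := der_continuous d1.
have [tM MP] := periodic_attains_max pi2 muc muT.
have [tm mP] := periodic_attains_min pi2 muc muT.
have M1 := derive_max0 (d1 tM) MP; have M2 := derive2_max_le0 d1 (d2 tM) MP.
have m1 := derive_min0 (d1 tm) mP; have m2 := derive2_min_ge0 d1 (d2 tm) mP.
have from_eq : mu tM <= mu tm -> exists m, forall t, mu t = m.
  move=> le; exists (mu tm) => t; apply/eqP; rewrite eq_le mP andbT.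
  exact: le_trans (MP t) le.
have rM := rel tM; have rm := rel tm; rewrite M1 m1 in rM rm.
have MM := mu0 tM; have mm := mu0 tm.
(* At an extremum the relation reduces to 2 mu mu'' = 2 a1 - 2 a2 mu^2, with the sign of mu'' known.
   Together the two bounds settle a2 <= 0. *)
have leM : a1 <= a2 * mu tM ^+ 2.
  have : mu tM * mu2 tM <= 0 by rewrite pmulr_rle0.
  by move: rM; rewrite expr0n/=; lra.
have lem : a2 * mu tm ^+ 2 <= a1.
  have : 0 <= mu tm * mu2 tm by rewrite pmulr_rge0.
  by move: rm; rewrite expr0n/=; lra.
have [neg|pos|z] := ltgtP a2 0; last by left; move: leM lem; rewrite z !mul0r; lra.
  right; apply: from_eq; have := le_trans lem leM.
  by rewrite ler_nM2l// ler_pXn2r// nnegrE ltW.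
right; pose k := Num.sqrt (2 * a2).
have k2 : k * k = 2 * a2 by rewrite -expr2 sqr_sqrtr//; lra.
have k0 : 0 < k by rewrite sqrtr_gt0; lra.
have k1 : k < 1.
  rewrite ltNge; apply/negP => kle.
  have : 1 * 1 <= k * k by apply: ler_pM.
  by rewrite k2; lra.
have mun t : mu t != 0 by rewrite gt_eqF.
(* A first integral of the relation; its constancy makes the relation linear, mu'' = - k^2 (mu -
   L). *)
pose J t := (mu1 t ^+ 2 + 2 * a1) / mu t + 2 * a2 * mu t.
have Jd : der J (fun=> 0).
  move=> t; rewrite /J; derive_solve; [exact: mun|].
  transitivity (mu1 t / mu t ^+ 2 *
    (2 * mu t * mu2 t - mu1 t ^+ 2 - 2 * a1 + 2 * a2 * mu t ^+ 2)); first by field.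
  by rewrite rel mulr0.
pose L := J 0 / (2 * (k * k)).
have mu2E t : mu2 t = - (k * k) * (mu t - L).
  have JE : J t = J 0 by exact: der0_const.
  have := rel t; rewrite /L -JE /J k2 => r; apply/eqP; rewrite -subr_eq0; apply/eqP.
  transitivity ((2 * mu t * mu2 t - mu1 t ^+ 2 - 2 * a1 + 2 * a2 * mu t ^+ 2) / (2 * mu t)).
    by field; rewrite mun gt_eqF.
  by rewrite r mul0r.
(* Over one period the constant [f] gives (mu t0 - L) (1 - cos (2 pi k)) = 0, and 0 < k < 1 makes
   the second factor positive. Maximum and minimum of [mu] therefore agree. *)
have crit t0 : mu1 t0 = 0 -> mu t0 = L.
  move=> c0; pose f t := mu1 t * sin (k * t + - k * t0) - k * (mu t - L) * cos (k * t + - k * t0).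
  have hs : der (@sin R) cos by move=> t; exact: is_derive_sin.
  have hc : der (@cos R) (fun t => - sin t) by move=> t; exact: is_derive_cos.
  have d_s := der_comp_affine k (- k * t0) hs; have d_c := der_comp_affine k (- k * t0) hc.
  have fd : der f (fun=> 0).
    by move=> t; rewrite /f; derive_solve; rewrite mu2E; ring.
  have := der0_const fd t0 (t0 + 2 * pi).
  have mu1T := der_periodic d1 muT.
  rewrite /f mu1T muT c0 !mul0r !sub0r.
  have -> : k * t0 + - k * t0 = 0 by ring.
  have -> : k * (t0 + 2 * pi) + - k * t0 = k * (2 * pi) by ring.
  rewrite cos0 mulr1 => /eqP; rewrite eqr_opp -subr_eq0 -{1}[k * _]mulr1 -mulrBr mulf_eq0.
  move=> /orP[|]; first by rewrite mulf_eq0 gt_eqF//= subr_eq0 => /eqP.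
  rewrite subr_eq0 => /eqP c1.
  have : cos (k * (2 * pi)) < 1.
    by apply: cos_lt1; rewrite mulr_gt0//= gtr_pMl.
  by rewrite -c1 ltxx.
by apply: from_eq; rewrite (crit _ M1) (crit _ m1).
Qed.

Lemma const_alpha_lt_half_uniq K x x1 x2 x3 z z1 z2 z3 (a1 a2 : R) (b1 b2 : R -> R) :
  normalized_lift K (2 * pi) x x1 x2 x3 -> normalized_lift K (2 * pi) z z1 z2 z3 ->
  (forall t, x3 t = - (2 * a1) *: x1 t - b1 t *: x t) ->
  (forall t, z3 t = - (2 * a2) *: z1 t - b2 t *: z t) ->
  a2 < 2^-1 -> a1 = a2.
Proof.
move=> lx lz ox oz a2h.
have [mu [mu1 [mu2 [muP muT d1 d2 rel]]]] := global_change lx lz ox oz.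
have mu0 t : 0 < mu t by have [] := muP t.
have [//|[m mE]] := periodic_ratio_const mu0 muT d1 d2 rel a2h.
have m0 : 0 < m by rewrite -(mE 0).
have m1 : 1 <= m.
  apply: (const_ratio_ge1 lx lz ox oz m0) => t.
  by have [_ [s ->]] := muP t; exists s; rewrite mE.
(* The same bound with the two lifts exchanged. *)
have m2 : 1 <= m^-1.
  have mi0 : 0 < m^-1 by rewrite invr_gt0.
  apply: (const_ratio_ge1 lz lx oz ox mi0) => s.
  have [nu nuP] := lift_param lz lx; have [nu0 [t xs]] := nuP s.
  have [_ [s' zt]] := muP t; rewrite mE in zt.
  exists t; rewrite xs; congr (_ *: _).
  have E : nu s * m = 1.
    apply: (lift_param_uniq lx (s := s') (s' := s)) => //; first exact: mulr_gt0.
    by rewrite scale1r -scalerA -zt -xs.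
  by rewrite -[RHS]mul1r -E mulfK// gt_eqF.
have mm : m = 1.
  apply/eqP; rewrite eq_le m1 andbT -[m]mul1r -ler_pdivlMr// div1r.
  by [].
have z1' t : mu1 t = 0.
  apply: is_derive_uniq (d1 t) _; have -> : mu = (fun=> m) by apply/funext.
  exact: is_derive_const.
have z2' t : mu2 t = 0.
  apply: is_derive_uniq (d2 t) _; have -> : mu1 = (fun=> 0) by apply/funext.
  exact: is_derive_const.
by have := rel 0; rewrite z1' z2' mE mm expr1n expr0n/=; lra.
Qed.

Lemma const_alpha_normalized K k y a (b : R -> R) : (5 <= k)%N -> regular_convex_cone K ->
  const_alpha_lift K k y a b ->
  exists y1 y2 y3 : R -> vec3 R, normalized_lift K (2 * pi) y y1 y2 y3 /\
    forall t, y3 t = - (2 * a) *: y1 t - b t *: y t.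
Proof.
move=> k5 HK [lb [Cy [_ [D [_ ode]]]]].
have pi2 : 0 < 2 * pi :> R by rewrite mulr_gt0 ?pi_gt0.
have k3 : (3 <= k - 2)%N by rewrite leq_subRL// (leq_trans _ k5).
have /CnS[y1 d1 /CnS[y2 d2 /CnS[y3 d3 _]]] := Cn_le k3 Cy.
have e1 : derive1n 1 y = y1 by exact: der_derive1.
have e2 : derive1n 2 y = y2 by rewrite derive1nS e1; exact: der_derive1.
have e3 : derive1n 3 y = y3 by rewrite derive1nS e2; exact: der_derive1.
rewrite e1 e2 in D; rewrite e1 e3 in ode.
exists y1, y2, y3; split; last first.
  by move=> t; apply/eqP; rewrite -subr_eq0 opprD !scaleNr !opprK addrA; apply/eqP.
by split; [exact: HK|exact: pi2|exact: lb|exact: d1|exact: d2|exact: d3|exact: D].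
Qed.

(** The comparison needs one of the constants below 1/2, and either one will do by symmetry;
    otherwise both equal the upper bound 1/2. *)
Lemma const_alpha_uniq K k y a (b : R -> R) y' a' (b' : R -> R) : (5 <= k)%N ->
  regular_convex_cone K -> const_alpha_lift K k y a b -> const_alpha_lift K k y' a' b' ->
  a' = a.
Proof.
move=> k5 HK /(const_alpha_normalized k5 HK)[y1 [y2 [y3 [l o]]]].
move=> /(const_alpha_normalized k5 HK)[z1 [z2 [z3 [l' o']]]].
have ah := const_alpha_le_half l o; have ah' := const_alpha_le_half l' o'.
have [lt|ge] := ltP a 2^-1; first exact: const_alpha_lt_half_uniq l' l o' o lt.
have [lt'|ge'] := ltP a' 2^-1.
  by apply/esym; exact: const_alpha_lt_half_uniq l l' o o' lt'.
by apply/eqP; rewrite eq_le (le_trans ah' ge) (le_trans ah ge').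
Qed.

End uniqueness.

Theorem theorem1 (R : realType) (K : set (vec3 R)) (k : nat) :
  (5 <= k)%N ->
  regular_convex_cone K ->
  Ck_pos_curved_boundary K k ->
  exists a : R,
    (exists (y : R -> vec3 R) (beta : R -> R), const_alpha_lift K k y a beta) /\
    (forall (y' : R -> vec3 R) (a' : R) (beta' : R -> R),
        const_alpha_lift K k y' a' beta' -> a' = a).
Proof.
move=> k5 HK HC; have [a [y [beta ya]]] := const_alpha_lift_exists k5 HK HC.
exists a; split; first by exists y, beta.
by move=> y' a' beta'; exact: const_alpha_uniq k5 HK ya.
Qed.
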